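(* Let $r,J\geq 1$ be integers. Suppose $p_{1},\ldots,p_{J}$ are NC $*$-polynomials in infinitely many variables that are homogeneous in the set of the first $2r$ variables, where $p_{j}$ has degree of homogeneity $d_{j}\geq 1$. Suppose $C_{1},\ldots,C_{J}>0$ are real constants. Let $A$ be any $C^{*}$-algebra, $I\vartriangleleft A$ an ideal, and $\pi:A\to A/I$ the quotient map. Given $x_{1},\ldots,x_{r}$, $y_{1},\ldots,y_{r}$ and $z_{1},z_{2},\ldots$ in $A$ with \[ \pi\left(x_{k}\right)\pi\left(y_{k}\right)\pi\left(x_{k}\right)^{*}=0\quad(k=1,\ldots,r) \] and \[ \left\Vert p_{j}\left(\pi(x_{1}),\ldots,\pi(x_{r}),\pi(y_{1}),\ldots,\pi(y_{r}),\pi(z_{1}),\pi(z_{2}),\ldots\right)\right\Vert \leq C_{j}\quad(j=1,\ldots,J), \] there are $\bar{x}_{1},\ldots,\bar{x}_{r}$ and $\bar{y}_{1},\ldots,\bar{y}_{r}$ in $A$ with $\pi(\bar{x}_{k})=\pi(x_{k})$ and $\pi(\bar{y}_{k})=\pi(y_{k})$ for $k=1,\ldots,r$, and \[ \bar{x}_{k}\bar{y}_{k}\bar{x}_{k}^{*}=0\quad(k=1,\ldots,r) \] and \[ \left\Vert p_{j}\left(\bar{x}_{1},\ldots,\bar{x}_{r},\bar{y}_{1},\ldots,\bar{y}_{r},z_{1},z_{2},\ldots\right)\right\Vert \leq C_{j}\quad(j=1,\ldots,J). \]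
   Context: Ideals of $C^{*}$-algebras are closed and two-sided. An NC $*$-polynomial is a (complex) polynomial in noncommuting variables and their formal adjoints; ''in infinitely many variables'' means the variables come from an infinite sequence, each polynomial involving only finitely many of them. A $*$-polynomial is homogeneous of degree $d$ for (or in) some subset $S$ of the variables when, in each of its monomials, the total number of times either $x$ or $x^{*}$ with $x\in S$ appears (counted with multiplicity, summed over all $x\in S$) is exactly $d$. The variables outside $S$ may appear arbitrarily. *)

(* Defs.v *)
From HB Require Import structures.
From mathcomp Require Import all_boot all_order all_algebra.
From mathcomp Require Import generic_quotient ring_quotient.
From mathcomp Require Import finmap complex.
From mathcomp Require Import (coercions, canonicals) monalg.
From mathcomp Require Import all_classical all_reals all_analysis.

Set Implicit Arguments.
Unset Strict Implicit.
Unset Printing Implicit Defensive.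

Import Order.TTheory GRing.Theory Num.Theory.
Import numFieldNormedType.Exports.

Local Open Scope classical_set_scope.
Local Open Scope ring_scope.
Local Open Scope complex_scope.
Local Open Scope quotient_scope.

Declare Scope nualg_scope.
Delimit Scope nualg_scope with NU.

(* Associative algebras that need not have a unit (mathcomp's algebras all    *)
(* have one).                                                                 *)
HB.mixin Record Lmodule_isNUAlgebra (K : pzRingType) A of GRing.Lmodule K A := {
  numul : A -> A -> A;
  numulA : associative numul;
  numulDl : left_distributive numul +%R;
  numulDr : right_distributive numul +%R;
  numulZl : forall (c : K) (a b : A), numul (c *: a) b = c *: numul a b;
  numulZr : forall (c : K) (a b : A), numul a (c *: b) = c *: numul a b
}.

#[short(type="nuAlgType")]
HB.structure Definition NUAlgebra (K : pzRingType) :=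
  {A of GRing.Lmodule K A & Lmodule_isNUAlgebra K A}.

HB.mixin Record hasStar A := { star : A -> A }.

(* The bare signature of *-algebras: the laws of the adjoint are only imposed *)
(* in C*-algebras, see isCStar.                                               *)
#[short(type="preStarAlgType")]
HB.structure Definition PreStarAlgebra (K : pzRingType) :=
  {A of NUAlgebra K A & hasStar A}.

Infix "**" := numul (at level 40, left associativity) : nualg_scope.
Local Open Scope nualg_scope.

HB.mixin Record isCStar (R : realType) A
    of CompleteNormedModule R[i] A & PreStarAlgebra R[i] A := {
  starD : {morph (@star _ A) : a b / a + b};
  starZ : forall (c : R[i]) (a : A), star (c *: a) = c^* *: star a;
  starM : forall a b : A, star (a ** b) = star b ** star a;
  starK : involutive (@star _ A);
  ler_normM : forall a b : A, `|a ** b| <= `|a| * `|b|;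
  cstar_norm : forall a : A, `|star a ** a| = `|a| ^+ 2
}.

#[short(type="cstarAlgType")]
HB.structure Definition CStarAlgebra (R : realType) :=
  {A of CompleteNormedModule R[i] A & PreStarAlgebra R[i] A & isCStar R A}.

(* Ideals of a C*-algebra: norm-closed two-sided ideals (linear subspaces     *)
(* absorbing products on both sides). Stability under star is a theorem, not  *)
(* a requirement.                                                             *)
Record cstarIdeal (R : realType) (A : cstarAlgType R) := CStarIdeal {
  ideal_pred :> {pred A};
  ideal_submod : submod_closed ideal_pred;
  ideal_mull : forall a b : A, b \in ideal_pred -> a ** b \in ideal_pred;
  ideal_mulr : forall a b : A, b \in ideal_pred -> b ** a \in ideal_pred;
  ideal_closed : closed [set a : A | a \in ideal_pred]
}.

HB.instance Definition _ (R : realType) (A : cstarAlgType R)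
    (I : cstarIdeal A) :=
  GRing.isSubmodClosed.Build R[i] A (ideal_pred I) (ideal_submod I).

Definition cquot (R : realType) (A : cstarAlgType R) (I : cstarIdeal A) :=
  Quotient.quot (ideal_pred I).

Section Quotient.
Variables (R : realType) (A : cstarAlgType R) (I : cstarIdeal A).
Local Notation Q := (cquot I).

HB.instance Definition _ := Choice.on Q.
HB.instance Definition _ := ZmodQuotient.on Q.
HB.instance Definition _ := GRing.Zmodule.on Q.

Lemma cquotP (a b : A) : reflect (\pi_Q a = \pi_Q b) (a - b \in I).
Proof. by rewrite Quotient.idealrBE; apply: eqP. Qed.

Lemma cquot_piD (a b : A) : \pi_Q (a + b) = \pi_Q a + \pi_Q b.
Proof. by rewrite !piE. Qed.

Lemma cquot_piN (a : A) : \pi_Q (- a) = - \pi_Q a.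
Proof. by rewrite !piE. Qed.

Lemma cquot_pi0 : \pi_Q (0 : A) = 0.
Proof. by rewrite !piE. Qed.

Definition cquot_scale (c : R[i]) : Q -> Q := lift_op1 Q ( *:%R c).

Lemma cquot_piZ c (a : A) : \pi_Q (c *: a) = cquot_scale c (\pi_Q a).
Proof.
unlock cquot_scale.
by apply/cquotP; rewrite -scalerBr rpredZ //; apply/cquotP; rewrite reprK.
Qed.

Fact cquot_scaleA c d q :
  cquot_scale c (cquot_scale d q) = cquot_scale (c * d) q.
Proof. by rewrite -[q]reprK -!cquot_piZ scalerA. Qed.

Fact cquot_scale1 : left_id 1 cquot_scale.
Proof. by move=> q; rewrite -[q]reprK -!cquot_piZ scale1r. Qed.

Fact cquot_scaleDr : right_distributive cquot_scale +%R.
Proof.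
move=> c p q; rewrite -[p]reprK -[q]reprK.
by rewrite -cquot_piD -!cquot_piZ scalerDr cquot_piD.
Qed.

Fact cquot_scaleDl q : {morph cquot_scale^~ q : c d / c + d}.
Proof.
by move=> c d; rewrite -[q]reprK -!cquot_piZ scalerDl cquot_piD.
Qed.

HB.instance Definition _ := GRing.Zmodule_isLmodule.Build R[i] Q
  cquot_scaleA cquot_scale1 cquot_scaleDr cquot_scaleDl.

Definition cquot_mul : Q -> Q -> Q := lift_op2 Q numul.

Lemma cquot_piM (a b : A) : \pi_Q (a ** b) = cquot_mul (\pi_Q a) (\pi_Q b).
Proof.
unlock cquot_mul; apply/cquotP; set a' := repr _; set b' := repr _.
have -> : a ** b - a' ** b' = (a - a') ** b + a' ** (b - b').
  rewrite numulDl numulDr -[- a']scaleN1r -[- b']scaleN1r numulZl numulZr.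
  by rewrite !scaleN1r addrA subrK.
by rewrite rpredD //; [apply: ideal_mulr|apply: ideal_mull];
  apply/cquotP; rewrite reprK.
Qed.

Fact cquot_mulA : associative cquot_mul.
Proof.
move=> p q s; rewrite -[p]reprK -[q]reprK -[s]reprK.
by rewrite -!cquot_piM numulA.
Qed.

Fact cquot_mulDl : left_distributive cquot_mul +%R.
Proof.
move=> p q s; rewrite -[p]reprK -[q]reprK -[s]reprK.
by rewrite -cquot_piD -!cquot_piM numulDl cquot_piD.
Qed.

Fact cquot_mulDr : right_distributive cquot_mul +%R.
Proof.
move=> p q s; rewrite -[p]reprK -[q]reprK -[s]reprK.
by rewrite -cquot_piD -!cquot_piM numulDr cquot_piD.
Qed.

Fact cquot_mulZl c p q :
  cquot_mul (cquot_scale c p) q = cquot_scale c (cquot_mul p q).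
Proof.
rewrite -[p]reprK -[q]reprK -(cquot_piM (repr p)) -!cquot_piZ -cquot_piM.
by rewrite numulZl.
Qed.

Fact cquot_mulZr c p q :
  cquot_mul p (cquot_scale c q) = cquot_scale c (cquot_mul p q).
Proof.
rewrite -[p]reprK -[q]reprK -(cquot_piM (repr p)) -!cquot_piZ -cquot_piM.
by rewrite numulZr.
Qed.

HB.instance Definition _ := Lmodule_isNUAlgebra.Build R[i] Q
  cquot_mulA cquot_mulDl cquot_mulDr cquot_mulZl cquot_mulZr.

(* (a + I)^* = a^* + I; independent of the representative because closed      *)
(* two-sided ideals of C*-algebras are self-adjoint.                          *)
HB.instance Definition _ := hasStar.Build Q (lift_op1 Q star).

(* The quotient norm |a + I| = inf {|b| : b - a \in I}.                       *)
Definition cquot_norms (q : Q) : set R :=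
  [set complex.Re `|a| | a in [set a : A | \pi_Q a = q]].

Definition cquot_norm (q : Q) : R[i] := (inf (cquot_norms q))%:C.

Lemma normRe (a : A) : (complex.Re `|a|)%:C = `|a|.
Proof. by rewrite RRe_real // normr_real. Qed.

Lemma normRe_ge0 (a : A) : 0 <= complex.Re `|a|.
Proof. by rewrite -(@lecR R) normRe normr_ge0. Qed.

Lemma cquot_norms_inf q : has_inf (cquot_norms q).
Proof.
split; first by exists (complex.Re `|repr q|), (repr q); rewrite //= reprK.
by exists 0 => _ [a _ <-]; apply: normRe_ge0.
Qed.

Lemma cquot_norm_le (a : A) q :
  \pi_Q a = q -> inf (cquot_norms q) <= complex.Re `|a|.
Proof.
by move=> pa; apply: ge_inf; [case: (cquot_norms_inf q)|exists a].
Qed.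

Lemma cquot_norm_adh q (e : R) : 0 < e ->
  exists2 a : A, \pi_Q a = q & complex.Re `|a| < inf (cquot_norms q) + e.
Proof.
by move=> /inf_adherent/(_ (cquot_norms_inf q))[_ [a pa <-] lt_a]; exists a.
Qed.

Lemma inf_cquot_norms_ge0 q : 0 <= inf (cquot_norms q).
Proof.
apply: lb_le_inf; first by case: (cquot_norms_inf q).
by move=> _ [a _ <-]; apply: normRe_ge0.
Qed.

Lemma inf_cquot_norms0 : inf (cquot_norms 0) = 0.
Proof.
apply/le_anti; rewrite inf_cquot_norms_ge0 andbT.
by have := cquot_norm_le cquot_pi0; rewrite normr0.
Qed.

Fact cquot_ler_normD p q :
  cquot_norm (p + q) <= cquot_norm p + cquot_norm q.
Proof.
rewrite /cquot_norm -rmorphD /= lecR; apply/ler_addgt0Pl => e e0.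
have e2 : 0 < e / 2 by rewrite divr_gt0.
have [a pa ha] := cquot_norm_adh p e2; have [b pb hb] := cquot_norm_adh q e2.
have pab : \pi_Q (a + b) = p + q by rewrite cquot_piD pa pb.
apply: le_trans (cquot_norm_le pab) _.
have : complex.Re `|a + b| <= complex.Re `|a| + complex.Re `|b|.
  by rewrite -(@lecR R) rmorphD /= !normRe ler_normD.
move=> /le_trans; apply; apply: le_trans (lerD (ltW ha) (ltW hb)) _.
by rewrite addrACA -splitr addrC.
Qed.

Fact cquot_normr0_eq0 q : cquot_norm q = 0 -> q = 0.
Proof.
move=> /(congr1 (@complex.Re R)) /= q0.
suff : repr q \in I.
  by rewrite -[repr q]subr0 => /cquotP; rewrite reprK cquot_pi0.
have := @ideal_closed _ _ I; rewrite closure_id => hI.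
suff : [set a : A | a \in I] (repr q) by [].
rewrite hI => B /= /nbhs_ballP[e /= e0 Be].
have re0 : 0 < complex.Re e.
  by rewrite -(@ltcR R) RRe_real // gtr0_real.
have [a pa] := cquot_norm_adh q re0; rewrite q0 add0r => ha.
exists (repr q - a); split.
  by apply/cquotP; rewrite pa reprK.
apply: Be; rewrite -ball_normE /= opprB addrC subrK.
by rewrite -normRe -[e]RRe_real ?ltcR // gtr0_real.
Qed.

Fact cquot_normrMn q n : cquot_norm (q *+ n) = cquot_norm q *+ n.
Proof.
elim: n => [|n _]; first by rewrite !mulr0n /cquot_norm inf_cquot_norms0.
apply/le_anti/andP; split.
  elim: n => [|n IHn]; first by rewrite !mulr1n.
  by rewrite [in leLHS]mulrS [in leRHS]mulrS (le_trans (cquot_ler_normD _ _)) // lerD2l.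
rewrite /cquot_norm -rmorphMn /= lecR.
apply: lb_le_inf; first by case: (cquot_norms_inf (q *+ n.+1)).
move=> _ [a pa <-].
have n0 : n.+1%:R != 0 :> R[i] by rewrite pnatr_eq0.
have pan : \pi_Q (n.+1%:R^-1 *: a) = q.
  rewrite cquot_piZ pa -[cquot_scale _ _]/(n.+1%:R^-1 *: (q *+ n.+1)).
  have -> : q *+ n.+1 = (n.+1%:R : R[i]) *: q by rewrite scaler_nat.
  by rewrite scalerA mulVf // scale1r.
have := cquot_norm_le pan.
rewrite -(@lecR R) normRe normrZ normfV normr_nat => hq.
rewrite -(@lecR R) normRe rmorphMn /= -mulr_natl.
by rewrite -[leRHS](mulVKf n0) ler_wpM2l.
Qed.

Fact cquot_normrN q : cquot_norm (- q) = cquot_norm q.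
Proof.
rewrite /cquot_norm; congr (inf _)%:C; apply/seteqP; split => _ [a pa <-].
  by exists (- a); rewrite /= ?normrN // cquot_piN pa opprK.
by exists (- a); rewrite /= ?normrN // cquot_piN pa.
Qed.

HB.instance Definition _ := Num.Zmodule_isNormed.Build R[i] Q
  cquot_ler_normD cquot_normr0_eq0 cquot_normrMn cquot_normrN.

End Quotient.

(* A letter (i, b) is the i-th variable if b = false and its formal adjoint   *)
(* if b = true; NC *-polynomials are the elements of the monoid algebra of    *)
(* the free monoid on these letters.                                          *)
Definition letter : choiceType := (nat * bool)%type.

Definition ncpoly (R : realType) := monalg.malg (monalg.fmonom letter) R[i].

Definition homogeneous (R : realType) (S : pred nat) (d : nat)
    (p : ncpoly R) : Prop :=
  forall m : monalg.fmonom letter, m \in monalg.msupp p ->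
    count (fun l : letter => S l.1) m = d.

Section Eval.
Variables (R : realType) (A : preStarAlgType R[i]) (v : nat -> A).

Definition eval_letter (l : letter) : A :=
  if l.2 then star (v l.1) else v l.1.

(* The empty word has no value in a non-unital algebra; the junk value 0 is   *)
(* irrelevant for polynomials that are homogeneous of positive degree.        *)
Definition eval_word (w : seq letter) : A :=
  if w is l :: w' then foldl (fun a l' => a ** eval_letter l') (eval_letter l) w'
  else 0.

Definition eval_ncpoly (p : ncpoly R) : A :=
  \sum_(m <- monalg.msupp p) monalg.mcoeff m p *: eval_word m.

End Eval.

(* The sequence x_1, ..., x_r, y_1, ..., y_r, z_1, z_2, ..., numbered from 0. *)
Definition xyz (T : Type) (r : nat) (x y : 'I_r -> T) (z : nat -> T)
    (i : nat) : T :=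
  if insub i is Some k then x k
  else if insub (i - r)%N is Some k then y k
  else z (i - 2 * r)%N.

(* Main.v *)
(* All analysis takes place in the unitization of A, along a quasicentral     *)
(* approximate unit u of I. If p is homogeneous of degree d, multiplying the  *)
(* first 2r variables by 1 - tu multiplies p by about (1 - tu)^d, so its norm *)
(* becomes about max (|pi(p)|, (1 - t)^d |p|). With t = 1 this produces lifts *)
(* that almost satisfy all the conditions; with t small it repairs a small    *)
(* excess over C_j at the cost of a small perturbation.                       *)
(* An element y for which x y x^* is small and lies in I is corrected by      *)
(* subtracting from y its compression, which lies in I, to the part where     *)
(* x^* x is not small; the remaining error lives where x is small, and        *)
(* disappears when x is cut off there. That cutoff changes x outside I, but   *)
(* it suffices to perform it only under u, i.e. to replace x by x - u m x.    *)
(* Alternating the two operations gives a Cauchy sequence of lifts, and its   *)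
(* limit satisfies all the conditions exactly.                                *)
Require Import Defs.
From HB Require Import structures.
From mathcomp Require Import all_boot all_order all_algebra.
From mathcomp Require Import generic_quotient complex.
From mathcomp Require Import all_classical all_reals all_analysis.
From mathcomp Require Import ring lra.

Set Implicit Arguments.
Unset Strict Implicit.
Unset Printing Implicit Defensive.

Import Order.TTheory GRing.Theory Num.Theory.
Import numFieldNormedType.Exports.
Local Open Scope ring_scope.
Local Open Scope complex_scope.
Local Open Scope quotient_scope.
Local Open Scope nualg_scope.

(** * Unitization *)

(** The main tool is a self-adjoint [u] in [I] that acts almost as 1 on finitely many given elements
    of [I] and almost commutes with finitely many given elements. Multiplying the first 2r variables
    by [1 - t u] changes them only modulo [I]. It multiplies a value of degree d by about the d-th
    power of [1 - t u] ([asymp_eval_ncpoly]), and [near_damp_mul_le] bounds the result by nearly the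
    larger of the quotient norm and [1 - t] times the old norm. As each [C j] is positive, an excess
    of order 1/s is thus removed by a t of order 1/s, moving the variables by O(1/s):
    [damping_step]. The relation is improved by [approximate_correction] and [correction_step]:
    changes of order 1/s inside [I] turn an error s^-20 into one of order s^-24. By Lipschitz
    continuity on bounded sets they spoil the norm bounds by O(1/s), which damping repairs.
    [lifting_step] combines both and doubles s; the moves are summable, and [lifting_exists] takes
    the limit, which stays in the given cosets because [I] is closed. The only functional calculus
    used is [spectral_cutoff]. It provides the cutoffs of the correction, the approximate units of
    [I] and the stability of [I] under [star]; averaging approximate units makes them quasicentral
    ([quasicentral_unit]). *)

Section NonUnitalAlgebra.
Variables (K : pzRingType) (A : nuAlgType K).
Implicit Types a b : A.

Lemma num0r a : 0 ** a = 0.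
Proof. by have := numulZl 0 0 a; rewrite !scale0r. Qed.

Lemma numr0 a : a ** 0 = 0.
Proof. by have := numulZr 0 a 0; rewrite !scale0r. Qed.

Lemma numulN a b : (- a) ** b = - (a ** b).
Proof. by rewrite -scaleN1r numulZl scaleN1r. Qed.

Lemma numulrN a b : a ** (- b) = - (a ** b).
Proof. by rewrite -scaleN1r numulZr scaleN1r. Qed.

Lemma numulBl a b c : (a - b) ** c = a ** c - b ** c.
Proof. by rewrite numulDl numulN. Qed.

Lemma numulBr a b c : c ** (a - b) = c ** a - c ** b.
Proof. by rewrite numulDr numulrN. Qed.

End NonUnitalAlgebra.

(** The pair [(c, a)] stands for the formal sum c + a. The alias keeps the componentwise module
    structure and receives its own product. *)
Definition unitization (K : comNzRingType) (A : nuAlgType K) : Type :=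
  (K^o * A)%type.

Section Unitization.
Variables (K : comNzRingType) (A : nuAlgType K).
Local Notation U := (unitization A).

HB.instance Definition _ := GRing.Lmodule.on U.

Definition unit_mul (m n : U) : U :=
  (m.1 * n.1, (m.1 : K) *: n.2 + (n.1 : K) *: m.2 + m.2 ** n.2).

Fact unit_mulA : associative unit_mul.
Proof.
move=> [c a] [d b] [e f]; congr pair => /=; first by rewrite mulrA.
rewrite !numulDl !numulDr !scalerDr !numulZl !numulZr !scalerA numulA.
rewrite !addrA [LHS](ACl (1*2*4*6*3*5*7)) /=.
by rewrite (mulrC c e) (mulrC d e).
Qed.

Fact unit_mul1r : left_id (1, 0) unit_mul.
Proof.
by move=> [c a]; congr pair => /=; rewrite ?mul1r // num0r scaler0 scale1r !addr0.
Qed.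

Fact unit_mulr1 : right_id (1, 0) unit_mul.
Proof.
by move=> [c a]; congr pair => /=; rewrite ?mulr1 // numr0 scaler0 scale1r add0r addr0.
Qed.

Fact unit_mulDl : left_distributive unit_mul +%R.
Proof.
move=> [c a] [d b] [e f]; congr pair => /=; first by rewrite mulrDl.
rewrite numulDl scalerDl scalerDr !addrA.
by rewrite [LHS](ACl (1*3*5*2*4*6)).
Qed.

Fact unit_mulDr : right_distributive unit_mul +%R.
Proof.
move=> [c a] [d b] [e f]; congr pair => /=; first by rewrite mulrDr.
rewrite numulDr scalerDl scalerDr !addrA.
by rewrite [LHS](ACl (1*3*5*2*4*6)).
Qed.

Fact unit_oner_neq0 : ((1, 0) : U) != 0.
Proof. by apply/eqP => -[/eqP]; rewrite oner_eq0. Qed.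

HB.instance Definition _ := GRing.Zmodule_isNzRing.Build U
  unit_mulA unit_mul1r unit_mulr1 unit_mulDl unit_mulDr unit_oner_neq0.

Fact unit_scalerAl (c : K) (m n : U) : c *: (m * n) = (c *: m) * n.
Proof.
case: m n => [d a] [e b]; congr pair => /=; first exact: mulrA.
by rewrite !scalerDr numulZl !scalerA; congr (_ + _ *: _ + _); rewrite mulrC.
Qed.

HB.instance Definition _ := GRing.Lmodule_isLalgebra.Build K U unit_scalerAl.

Fact unit_scalerAr (c : K) (m n : U) : c *: (m * n) = m * (c *: n).
Proof.
case: m n => [d a] [e b]; congr pair => /=; first exact: mulrCA.
by rewrite !scalerDr numulZr !scalerA; congr (_ *: _ + _ + _); rewrite mulrC.
Qed.

HB.instance Definition _ := GRing.Lalgebra_isAlgebra.Build K U unit_scalerAr.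

Definition inu (a : A) : U := (0, a).

Fact inu_is_linear : linear inu.
Proof. by move=> c a b; congr pair; rewrite /= scaler0 addr0. Qed.

HB.instance Definition _ := GRing.isLinear.Build K A U *:%R inu inu_is_linear.

Lemma inuD a b : inu (a + b) = inu a + inu b.
Proof. exact: raddfD. Qed.

Lemma inuB a b : inu (a - b) = inu a - inu b.
Proof. exact: raddfB. Qed.

Lemma inu0 : inu 0 = 0.
Proof. exact: raddf0. Qed.

Lemma inuZ c a : inu (c *: a) = c *: inu a.
Proof. exact: linearZ. Qed.

Lemma inuM a b : inu (a ** b) = inu a * inu b.
Proof. by congr pair; rewrite /= ?mul0r // !scale0r !add0r. Qed.

Lemma inu_inj : injective inu.
Proof. by move=> a b []. Qed.

(** [A] is an ideal of its unitization; [lact] and [ract] return such products as elements of [A].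
    Identities between them are checked in the ring [U] through injectivity of [inu]. *)
Definition lact (m : U) (a : A) : A := (m.1 : K) *: a + m.2 ** a.
Definition ract (a : A) (m : U) : A := (m.1 : K) *: a + a ** m.2.

Lemma inu_lact m a : inu (lact m a) = m * inu a.
Proof. by congr pair; rewrite /= ?mulr0 // scale0r addr0. Qed.

Lemma inu_ract m a : inu (ract a m) = inu a * m.
Proof. by congr pair; rewrite /= ?mul0r // scale0r add0r. Qed.

End Unitization.

(** * Real-valued norms and geometrically convergent sequences *)

Section RealNorm.
Variable R : realType.

Definition rnorm (V : normedModType R[i]) (a : V) : R := complex.Re `|a|.

Section NormedModule.
Variable V : normedModType R[i].
Implicit Types a b : V.

Lemma rnormE a : (rnorm a)%:C = `|a|.
Proof. by rewrite /rnorm RRe_real // normr_real. Qed.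

Lemma rnorm_ge0 a : 0 <= rnorm a.
Proof. by rewrite -lecR rnormE normr_ge0. Qed.

Lemma rnorm0 : rnorm (0 : V) = 0.
Proof. by rewrite /rnorm normr0. Qed.

Lemma rnorm_eq0 a : rnorm a = 0 -> a = 0.
Proof. by move=> a0; apply/eqP; rewrite -normr_eq0 -rnormE a0. Qed.

Lemma rnormN a : rnorm (- a) = rnorm a.
Proof. by rewrite /rnorm normrN. Qed.

Lemma rnormB a b : rnorm (a - b) = rnorm (b - a).
Proof. by rewrite -opprB rnormN. Qed.

Lemma rnormD a b : rnorm (a + b) <= rnorm a + rnorm b.
Proof. by rewrite -lecR rmorphD /= !rnormE ler_normD. Qed.

Lemma rnorm_tri c a b : rnorm (a - b) <= rnorm (a - c) + rnorm (c - b).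
Proof. by have := rnormD (a - c) (c - b); rewrite addrA subrK. Qed.

Lemma rnormZ (c : R[i]) a : rnorm (c *: a) = complex.Re `|c| * rnorm a.
Proof.
by apply: (@complexI R); rewrite rmorphM /= !rnormE normrZ.
Qed.

Lemma rnormZr (c : R) a : rnorm (c%:C *: a) = `|c| * rnorm a.
Proof. by rewrite rnormZ normc_def /= expr0n addr0 sqrtr_sqr. Qed.

Lemma rnorm_eps0 a : (forall e : R, 0 < e -> rnorm a <= e) -> a = 0.
Proof.
move=> ae; apply: rnorm_eq0; apply/le_anti; rewrite rnorm_ge0 andbT.
by apply/ler_addgt0Pl => e e0; rewrite addr0 ae.
Qed.

End NormedModule.

Lemma le0_cases (x : R) : 0 <= x -> x = 0 \/ 0 < x.
Proof. by rewrite le_eqVlt => /orP[/eqP|]; auto. Qed.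

Lemma exp_half_small (c e : R) : 0 < e -> exists i, c * 2^-1 ^+ i <= e.
Proof.
move=> e0; exists (Num.bound (c / e)).
have p0 : 0 < 2 ^+ Num.bound (c / e) :> R by rewrite exprn_gt0.
rewrite exprVn ler_pdivrMr // mulrC -ler_pdivrMr //.
by apply/ltW/upper_nthrootP.
Qed.

Lemma geometric_cauchy_cvg (V : completeNormedModType R[i]) (a : nat -> V) (c : R) :
  (forall i, rnorm (a i.+1 - a i) <= c * 2^-1 ^+ i) ->
  exists l, forall i, rnorm (a i - l) <= 2 * c * 2^-1 ^+ i.
Proof.
move=> ac.
have c0 : 0 <= c by have := ac 0%N; rewrite expr0 mulr1; apply: le_trans (rnorm_ge0 _).
have p0 i : 0 <= 2^-1 ^+ i :> R by rewrite exprn_ge0 // invr_ge0.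
(* The factor [1 - 2^-1 ^+ k] is the exact partial geometric sum; it is what lets the induction on
   [k] close. *)
have adist i k : rnorm (a (i + k)%N - a i) <= 2 * c * 2^-1 ^+ i * (1 - 2^-1 ^+ k).
  elim: k => [|k IH]; first by rewrite addn0 subrr rnorm0 expr0 subrr mulr0.
  apply: le_trans (rnorm_tri (a (i + k)%N) _ _) _; rewrite addnS.
  apply: le_trans (lerD (ac _) IH) _.
  rewrite exprD exprS; have := p0 i; have := p0 k.
  move: (2^-1 ^+ i) (2^-1 ^+ k) => x y hx hy; lra.
have adist' i k : rnorm (a (i + k)%N - a i) <= 2 * c * 2^-1 ^+ i.
  apply: le_trans (adist i k) _; rewrite ler_piMr ?gerBl ?p0 //.
  by rewrite mulr_ge0 ?p0 // mulr_ge0.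
have acau : cauchy (fmap a eventually).
  apply: cauchy_exP => eps eps0; have eE : (complex.Re eps)%:C = eps.
    by rewrite RRe_real // gtr0_real.
  have e0 : 0 < complex.Re eps by rewrite -ltcR eE.
  have e2 : 0 < complex.Re eps / 2 by rewrite divr_gt0.
  have [i hi] := exp_half_small (2 * c) e2.
  exists (a i), i => // j /= ij; rewrite -ball_normE /= -rnormE -eE ltcR rnormB.
  rewrite -(subnKC ij); apply: le_lt_trans (adist' _ _) _.
  by apply: le_lt_trans hi _; lra.
have /cauchy_cvgP/cvg_ex[l al] := acau.
exists l => i; apply/ler_addgt0Pl => e e0.
have /cvgrPdist_lt/(_ e%:C) := al; rewrite ltcR => /(_ e0) [k _ /= hk].
have := hk (i + k)%N (leq_addl _ _); rewrite -rnormE ltcR => hl.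
apply: le_trans (rnorm_tri (a (i + k)%N) _ _) _; rewrite addrC lerD //.
  by rewrite rnormB ltW.
by rewrite rnormB.
Qed.


End RealNorm.

(** * Adjoint and C*-seminorm on the unitization *)

Section CStarNorm.
Variables (R : realType) (A : cstarAlgType R).
Implicit Types a b : A.

Lemma star0 : star (0 : A) = 0.
Proof. by have := starZ 0 (0 : A); rewrite conjC0 !scale0r. Qed.

Lemma starN a : star (- a) = - star a.
Proof. by rewrite -scaleN1r starZ rmorphN rmorph1 scaleN1r. Qed.

Lemma starB a b : star (a - b) = star a - star b.
Proof. by rewrite starD starN. Qed.

Lemma conjC_real_complex (t : R) : Num.conj t%:C = t%:C :> R[i].
Proof. exact: conjc_real. Qed.

Lemma starZr (c : R) a : star (c%:C *: a) = c%:C *: star a.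
Proof. by rewrite starZ conjC_real_complex. Qed.

Lemma rnormM a b : rnorm (a ** b) <= rnorm a * rnorm b.
Proof. by rewrite -lecR rmorphM /= !rnormE ler_normM. Qed.

Lemma rnorm_cstar a : rnorm (star a ** a) = rnorm a ^+ 2.
Proof. by apply: (@complexI R); rewrite rmorphXn /= !rnormE cstar_norm. Qed.

Lemma rnorm_star a : rnorm (star a) = rnorm a.
Proof.
suff le b : rnorm b <= rnorm (star b).
  by apply/le_anti; rewrite le -{2}[a]starK le.
have [->|b0] := le0_cases (rnorm_ge0 b); first exact: rnorm_ge0.
by rewrite -(ler_pM2r b0) -expr2 -rnorm_cstar rnormM.
Qed.

Lemma rnorm_cstarr a : rnorm (a ** star a) = rnorm a ^+ 2.
Proof. by rewrite -{1}[a]starK rnorm_cstar rnorm_star. Qed.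

Local Notation U := (unitization A).
Implicit Types m n : U.

Definition ustar m : U := (Num.conj (m.1 : R[i]), star m.2).

Lemma ustarD m n : ustar (m + n) = ustar m + ustar n.
Proof. by congr pair; rewrite /= ?rmorphD ?starD. Qed.

Lemma ustarN m : ustar (- m) = - ustar m.
Proof. by congr pair; rewrite /= ?rmorphN ?starN. Qed.

Lemma ustarB m n : ustar (m - n) = ustar m - ustar n.
Proof. by rewrite ustarD ustarN. Qed.

Lemma ustarM m n : ustar (m * n) = ustar n * ustar m.
Proof.
congr pair; rewrite /= ?rmorphM 1?mulrC // !starD !starZ starM.
by congr (_ + _); rewrite addrC.
Qed.

Lemma ustar1 : ustar 1 = 1.
Proof. by congr pair; rewrite /= ?conjC1 ?star0. Qed.

Lemma ustarK : involutive ustar.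
Proof. by move=> [c a]; rewrite /ustar /= conjCK starK. Qed.

Lemma ustarZ (c : R[i]) m : ustar (c *: m) = Num.conj c *: ustar m.
Proof. by congr pair; rewrite /= ?rmorphM ?starZ. Qed.

Lemma ustarZr (c : R) m : ustar (c%:C *: m) = c%:C *: ustar m.
Proof. by rewrite ustarZ conjC_real_complex. Qed.

Lemma ustarX m k : ustar (m ^+ k) = ustar m ^+ k.
Proof.
by elim: k => [|k IH]; rewrite ?ustar1 // exprS ustarM IH -exprSr.
Qed.

Lemma ustar_inu a : ustar (inu a) = inu (star a).
Proof. by congr pair; rewrite /= conjC0. Qed.

(* Operator seminorm of left multiplication on [A]; it is not a norm when [A] *)
(* already has a unit.                                                        *)
Definition unorm_set m : set R :=
  [set rnorm (lact m b) | b in [set b : A | rnorm b <= 1]]%classic.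

Definition unorm m : R := sup (unorm_set m).

Lemma unorm_set_has_sup m : has_sup (unorm_set m).
Proof.
split; first by exists (rnorm (lact m 0)), 0; rewrite //= rnorm0.
exists (complex.Re `|(m.1 : R[i])| + rnorm m.2) => _ [b /= b1 <-].
apply: le_trans (rnormD _ _) _; rewrite rnormZ lerD //.
  by rewrite ler_piMr // (rnorm_ge0 (m.1 : R[i]^o)).
by apply: le_trans (rnormM _ _) _; rewrite ler_piMr ?rnorm_ge0.
Qed.

Lemma unorm_ge0 m : 0 <= unorm m.
Proof.
apply: le_trans (rnorm_ge0 (lact m 0)) _; apply: ub_le_sup.
  by case: (unorm_set_has_sup m).
by exists 0; rewrite //= rnorm0.
Qed.

Lemma lact_add m n b : lact (m + n) b = lact m b + lact n b.
Proof. by apply: inu_inj; rewrite inuD !inu_lact mulrDl. Qed.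

Lemma lactM m n b : lact (m * n) b = lact m (lact n b).
Proof. by apply: inu_inj; rewrite !inu_lact mulrA. Qed.

Lemma lactZr m (c : R[i]) b : lact m (c *: b) = c *: lact m b.
Proof. by apply: inu_inj; rewrite inu_lact !inuZ inu_lact -scalerAr. Qed.

Lemma lactZ m (c : R[i]) b : lact (c *: m) b = c *: lact m b.
Proof. by apply: inu_inj; rewrite inuZ !inu_lact -scalerAl. Qed.

Lemma lact1 b : lact 1 b = b.
Proof. by apply: inu_inj; rewrite inu_lact mul1r. Qed.

Lemma lact_inu a b : lact (inu a) b = a ** b.
Proof. by apply: inu_inj; rewrite inu_lact inuM. Qed.

Lemma unormP m b : rnorm (lact m b) <= unorm m * rnorm b.
Proof.
have [/rnorm_eq0 ->|b0] := eqVneq (rnorm b) 0.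
  by have := lactZr m 0 0; rewrite !scale0r => ->; rewrite rnorm0 mulr0.
have bp : 0 < rnorm b by rewrite lt_neqAle eq_sym b0 rnorm_ge0.
rewrite -ler_pdivrMr // mulrC.
have -> : (rnorm b)^-1 * rnorm (lact m b) = rnorm (lact m ((rnorm b)^-1%:C *: b)).
  by rewrite lactZr rnormZr ger0_norm // invr_ge0 ltW.
apply: ub_le_sup; first by case: (unorm_set_has_sup m).
exists ((rnorm b)^-1%:C *: b) => //=.
by rewrite rnormZr ger0_norm ?mulVf // invr_ge0 ltW.
Qed.

Lemma unorm_le m c : 0 <= c -> (forall b, rnorm (lact m b) <= c * rnorm b) -> unorm m <= c.
Proof.
move=> c0 mc; apply: ge_sup; first by case: (unorm_set_has_sup m).
by move=> _ [b /= b1 <-]; apply: le_trans (mc b) _; rewrite ler_piMr.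
Qed.

Lemma unormD m n : unorm (m + n) <= unorm m + unorm n.
Proof.
apply: unorm_le => [|b]; first by rewrite addr_ge0 // unorm_ge0.
rewrite lact_add; apply: le_trans (rnormD _ _) _.
by rewrite mulrDl lerD // unormP.
Qed.

Lemma unormZ (c : R[i]) m : unorm (c *: m) <= complex.Re `|c| * unorm m.
Proof.
have c0 : 0 <= complex.Re `|c| := rnorm_ge0 (c : R[i]^o).
apply: unorm_le => [|b]; first by rewrite mulr_ge0 // unorm_ge0.
by rewrite lactZ rnormZ -mulrA ler_wpM2l // unormP.
Qed.

Lemma unormZr (c : R) m : 0 <= c -> unorm (c%:C *: m) <= c * unorm m.
Proof.
move=> c0; apply: le_trans (unormZ _ _) _.
by rewrite normc_def /= expr0n addr0 sqrtr_sqr ger0_norm.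
Qed.

Lemma unormM m n : unorm (m * n) <= unorm m * unorm n.
Proof.
apply: unorm_le => [|b]; first by rewrite mulr_ge0 // unorm_ge0.
rewrite lactM; apply: le_trans (unormP _ _) _.
by rewrite -mulrA ler_wpM2l ?unorm_ge0 // unormP.
Qed.

Lemma unorm1_le : unorm 1 <= 1.
Proof. by apply: unorm_le => // b; rewrite lact1 mul1r. Qed.

(** Testing left multiplication by [a] on [star a] attains the norm, by the C*-identity. Hence
    estimates made in the unitization return to [A] without loss. *)
Lemma unorm_inu a : unorm (inu a) = rnorm a.
Proof.
apply/le_anti/andP; split.
  by apply: unorm_le => [|b]; rewrite ?rnorm_ge0 // lact_inu rnormM.
have [->|a0] := le0_cases (rnorm_ge0 a); first exact: unorm_ge0.
have := unormP (inu a) (star a).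
by rewrite lact_inu rnorm_cstarr rnorm_star expr2 ler_pM2r.
Qed.

Lemma unormN m : unorm (- m) = unorm m.
Proof.
suff le n : unorm (- n) <= unorm n.
  by apply/le_anti; rewrite le -{1}[m]opprK le.
rewrite -scaleN1r; apply: le_trans (unormZ _ _) _.
by rewrite normrN normr1 mul1r.
Qed.

Lemma unormB m n : unorm (m - n) = unorm (n - m).
Proof. by rewrite -opprB unormN. Qed.

Lemma unorm0 : unorm 0 = 0.
Proof. by rewrite -(inu0 A) unorm_inu rnorm0. Qed.

Lemma unorm_tri k m n : unorm (m - n) <= unorm (m - k) + unorm (k - n).
Proof. by have := unormD (m - k) (k - n); rewrite addrA subrK. Qed.

(** The C*-identity of [A], applied to m b, moves both factors [m] together: the square of |m b| is
    the norm of [star b] times [ustar m * m] times [b]. *)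
Lemma unorm_cstar_le m : unorm m ^+ 2 <= unorm (ustar m * m).
Proof.
rewrite -[leRHS]sqr_sqrtr ?unorm_ge0 // ler_sqr ?nnegrE ?unorm_ge0 ?sqrtr_ge0 //.
apply: unorm_le => [|b]; first exact: sqrtr_ge0.
rewrite -ler_sqr ?nnegrE ?mulr_ge0 ?sqrtr_ge0 ?rnorm_ge0 //.
rewrite exprMn sqr_sqrtr ?unorm_ge0 // -rnorm_cstar.
have -> : star (lact m b) ** lact m b = star b ** lact (ustar m * m) b.
  apply: inu_inj; rewrite !inuM -!ustar_inu !inu_lact ustarM.
  by rewrite !mulrA.
apply: le_trans (rnormM _ _) _; rewrite rnorm_star expr2 mulrA mulrC.
by rewrite ler_wpM2r ?rnorm_ge0 // unormP.
Qed.

Lemma unorm_star m : unorm (ustar m) = unorm m.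
Proof.
suff le n : unorm n <= unorm (ustar n).
  by apply/le_anti; rewrite le -{2}[m]ustarK le.
have [->|b0] := le0_cases (unorm_ge0 n); first exact: unorm_ge0.
rewrite -(ler_pM2r b0) -expr2; apply: le_trans (unorm_cstar_le _) _.
exact: unormM.
Qed.

Lemma unorm_cstar m : unorm (ustar m * m) = unorm m ^+ 2.
Proof.
apply/le_anti; rewrite unorm_cstar_le andbT.
by apply: le_trans (unormM _ _) _; rewrite unorm_star expr2.
Qed.

Lemma unormX_le1 m k : unorm m <= 1 -> unorm (m ^+ k) <= 1.
Proof.
move=> m1; elim: k => [|k IH]; first exact: unorm1_le.
by rewrite exprS (le_trans (unormM _ _)) // mulr_ile1 ?unorm_ge0.
Qed.

Lemma unormX m k : unorm (m ^+ k) <= unorm m ^+ k.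
Proof.
elim: k => [|k IH]; first by rewrite expr0 unorm1_le.
rewrite !exprS; apply: le_trans (unormM _ _) _.
by rewrite ler_wpM2l ?unorm_ge0.
Qed.

Lemma unorm_sum (T : Type) (s : seq T) (P : pred T) (F : T -> U) :
  unorm (\sum_(i <- s | P i) F i) <= \sum_(i <- s | P i) unorm (F i).
Proof.
elim/big_rec2: _ => [|i x y _ le]; first by rewrite unorm0.
by apply: le_trans (unormD _ _) _; rewrite lerD2l.
Qed.

End CStarNorm.

(** * Functional calculus for one self-adjoint element *)

Section SquareRoot.
Variables (R : realType) (A : cstarAlgType R).
Local Notation U := (unitization A).

Lemma real_scaleK (V : lmodType R[i]) (c : R) (a : V) :
  c != 0 -> c%:C *: (c^-1%:C *: a) = a.
Proof. by move=> c0; rewrite scalerA -rmorphM /= divff // rmorph1 scale1r. Qed.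

Lemma real_scale2 (V : lmodType R[i]) (a : V) : 2%:C *: a = a + a.
Proof. by rewrite rmorph_nat scaler_nat mulr2n. Qed.

(* [1 - r] is the square root of [1 - h ^ 2]; as [r] solves                   *)
(* [r = (h ^ 2 + r ^ 2) / 2], it is the limit of an iteration that contracts  *)
(* the ball of radius 1/2.                                                    *)
Lemma sqrt_one_sub_sqr (h : A) : star h = h -> rnorm h <= 2^-1 ->
  exists r : A, [/\ star r = r, h ** r = r ** h & r + r = h ** h + r ** r].
Proof.
move=> hs hn.
pose f (r : A) := 2^-1%:C *: (h ** h + r ** r).
pose r i := iter i f (0 : A).
have h2 : 0 <= 2^-1 :> R by rewrite invr_ge0.
have nhh : rnorm (h ** h) <= 2^-1 * 2^-1.
  by apply: le_trans (rnormM _ _) _; rewrite ler_pM ?rnorm_ge0.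
have fle (a : A) : rnorm a <= 2^-1 -> rnorm (f a) <= 2^-1.
  move=> an; rewrite rnormZr ger0_norm //.
  have : rnorm (a ** a) <= 2^-1 * 2^-1.
    by apply: le_trans (rnormM _ _) _; rewrite ler_pM ?rnorm_ge0.
  have := rnormD (h ** h) (a ** a); lra.
have ffB (a b : A) : rnorm a <= 2^-1 -> rnorm b <= 2^-1 ->
    rnorm (f a - f b) <= 2^-1 * rnorm (a - b).
  move=> an bn; rewrite -scalerBr rnormZr ger0_norm // ler_wpM2l //.
  have -> : h ** h + a ** a - (h ** h + b ** b) = a ** (a - b) + (a - b) ** b.
    by rewrite numulBr numulBl opprD addrACA subrr add0r addrA subrK.
  apply: le_trans (rnormD _ _) _.
  have h1 : rnorm (a ** (a - b)) <= 2^-1 * rnorm (a - b).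
    by apply: le_trans (rnormM _ _) _; rewrite ler_wpM2r ?rnorm_ge0.
  have h3 : rnorm ((a - b) ** b) <= rnorm (a - b) * 2^-1.
    by apply: le_trans (rnormM _ _) _; rewrite ler_wpM2l ?rnorm_ge0.
  lra.
have rn i : rnorm (r i) <= 2^-1.
  by elim: i => [|i IH]; [rewrite rnorm0|apply: fle].
have rs i : star (r i) = r i.
  elim: i => [|i IH]; first exact: star0.
  by rewrite /r iterS -/(r i) starZr starD !starM hs IH.
have rc i : h ** r i = r i ** h.
  elim: i => [|i IH]; first by rewrite /r /= numr0 num0r.
  rewrite /r iterS -/(r i) numulZl numulZr numulDl numulDr.
  by rewrite numulA (numulA h (r i)) IH -(numulA (r i) h) IH numulA.
have rcau i : rnorm (r i.+1 - r i) <= 1 * 2^-1 ^+ i.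
  elim: i => [|i IH].
    rewrite /r /= subr0 mulr1 (le_trans (fle 0 _)) ?rnorm0 //; lra.
  have := ffB _ _ (rn i.+1) (rn i); rewrite -[f (r i.+1)]/(r i.+2) -[f (r i)]/(r i.+1).
  by move=> /le_trans; apply; rewrite exprS mulrCA ler_wpM2l.
have [l hl] := geometric_cauchy_cvg rcau.
have ln : rnorm l <= 2^-1.
  apply/ler_addgt0Pl => e e0; have [i hi] := exp_half_small (2 * 1) e0.
  have := rnormD (l - r i) (r i); rewrite subrK => /le_trans; apply.
  by rewrite lerD // rnormB (le_trans (hl i)).
exists l; split.
- apply/eqP; rewrite -subr_eq0; apply/eqP; apply: rnorm_eps0 => e e0.
  have [i hi] := exp_half_small (4 * 1) e0.
  have := rnorm_tri (r i) (star l) l.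
  have -> : rnorm (star l - r i) = rnorm (r i - l).
    by rewrite -(rs i) -starB rnorm_star rs rnormB.
  have := hl i; lra.
- apply/eqP; rewrite -subr_eq0; apply/eqP; apply: rnorm_eps0 => e e0.
  have [i hi] := exp_half_small (4 * 1) e0.
  have -> : h ** l - l ** h = h ** (l - r i) - (l - r i) ** h.
    by rewrite numulBr numulBl rc opprB addrA subrK.
  apply: le_trans (rnormD _ _) _; rewrite rnormN.
  have := rnormM h (l - r i); have := rnormM (l - r i) h.
  have := hl i; rewrite (rnormB (r i)) => hli.
  have := ler_pM (rnorm_ge0 _) (rnorm_ge0 _) hn hli.
  rewrite (mulrC (rnorm (l - _))); lra.
- have -> : h ** h + l ** l = 2%:C *: f l by rewrite real_scaleK ?pnatr_eq0.
  rewrite -real_scale2; congr (_ *: _).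
  apply/eqP; rewrite -subr_eq0; apply/eqP; apply: rnorm_eps0 => e e0.
  have [i hi] := exp_half_small (4 * 1) e0.
  have := rnorm_tri (r i.+1) l (f l).
  have := ffB _ _ (rn i) ln; rewrite -[f (r i)]/(r i.+1).
  have := hl i; have := hl i.+1; rewrite (rnormB (r i.+1)) exprS; lra.
Qed.

(** Take w = h + i s with s = 1 - r: the equation for [r] says exactly that the squares of [h] and s
    add up to 1, and the two commute. *)
Lemma cosine_unitary (h : A) : star h = h -> rnorm h <= 2^-1 ->
  exists w : U, [/\ ustar w * w = 1, w * ustar w = 1 & w + ustar w = 2%:C *: inu h].
Proof.
move=> hs hn; have [r [rs rc r2]] := sqrt_one_sub_sqr hs hn.
pose s : U := 1 - inu r.
have ss : ustar s = s by rewrite ustarB ustar1 ustar_inu rs.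
have hsc : inu h * s = s * inu h.
  by rewrite mulrBl mulrBr mul1r mulr1 -!inuM rc.
have hh : ustar (inu h) = inu h by rewrite ustar_inu hs.
have one : inu h * inu h + s * s = 1.
  have e : inu h * inu h + inu r * inu r = inu r + inu r.
    by rewrite -!inuM -!inuD r2.
  rewrite mulrBl mul1r mulrBr mulr1 opprB !addrA.
  by rewrite [LHS](ACl ((1*4)*(3*5)*2)) /= e -opprD subrr add0r.
pose t : U := 'i%C *: s.
have tt : t * t = - (s * s).
  by rewrite -scalerAl -scalerAr scalerA -expr2 sqr_i scaleN1r.
have ht : inu h * t = t * inu h by rewrite -scalerAl -scalerAr hsc.
exists (inu h + t).
have -> : ustar (inu h + t) = inu h - t.
  rewrite ustarD hh ustarZ ss; congr (_ + _); rewrite -scaleNr; congr (_ *: _).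
  by congr Complex; rewrite oppr0.
split; last by rewrite real_scale2 addrACA subrr addr0.
- by rewrite mulrBl !mulrDr ht opprD addrA addrK tt opprK.
- by rewrite mulrDl !mulrBr ht addrA subrK tt opprK.
Qed.

Section FejerMean.
Implicit Types b : U.

(** As in the mean ergodic theorem, these averages of powers of a contraction [b] are nearly
    annihilated by [1 - b]. [fejer_quot] is the quotient of [1 - fejer n b] by [1 - b]. *)
Definition fejer n b : U := n%:R^-1%:C *: \sum_(j < n) b ^+ j.
Definition fejer_quot n b : U :=
  n%:R^-1%:C *: \sum_(j < n) \sum_(i < j) b ^+ i.

Lemma unorm_sum_le n (F : nat -> U) c :
  (forall j, (j < n)%N -> unorm (F j) <= c) ->
  unorm (\sum_(j < n) F j) <= n%:R * c.
Proof.
move=> Fc; apply: le_trans (unorm_sum _ _ _) _.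
rewrite mulr_natl -[n in leRHS]card_ord -sumr_const.
by apply: ler_sum => j _; apply: Fc.
Qed.

Lemma comm_sum_expr n (g b : U) : GRing.comm g b -> GRing.comm g (\sum_(j < n) b ^+ j).
Proof. by move=> gb; apply: commr_sum => j _; apply: commrX. Qed.

Lemma geometric_sum_mul n b : (\sum_(i < n) b ^+ i) * (1 - b) = 1 - b ^+ n.
Proof.
elim: n => [|n IH]; first by rewrite big_ord0 mul0r subrr.
by rewrite big_ord_recr mulrDl IH mulrBr mulr1 -exprSr addrA subrK.
Qed.

Lemma comm_scale (g b : U) c : GRing.comm g b -> GRing.comm g (c *: b).
Proof. by move=> gb; rewrite /GRing.comm -scalerAr gb scalerAl. Qed.

Lemma comm_fejer n g b : GRing.comm g b -> GRing.comm g (fejer n b).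
Proof. by move=> gb; apply/comm_scale/comm_sum_expr. Qed.

Lemma comm_fejer_quot n g b : GRing.comm g b -> GRing.comm g (fejer_quot n b).
Proof. by move=> gb; apply/comm_scale/commr_sum => j _; apply: comm_sum_expr. Qed.

Lemma sub1_fejer n b : (0 < n)%N -> 1 - fejer n b = fejer_quot n b * (1 - b).
Proof.
move=> n0; have nn : n%:R != 0 :> R by rewrite pnatr_eq0 -lt0n.
apply: (scalerI (a := n%:R%:C)); first by rewrite rmorph_nat pnatr_eq0 -lt0n.
rewrite -scalerAl scalerBr !real_scaleK // mulr_suml.
under [RHS]eq_bigr do rewrite geometric_sum_mul.
by rewrite sumrB sumr_const card_ord rmorph_nat scaler_nat.
Qed.

Lemma sub1_mul_fejer n b : (1 - b) * fejer n b = n%:R^-1%:C *: (1 - b ^+ n).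
Proof.
rewrite -scalerAr -geometric_sum_mul; congr (_ *: _); apply: commr_sym.
by apply: commrB; [apply: commr1|apply/commr_sym/comm_sum_expr].
Qed.

Variables (n : nat) (b : U).
Hypotheses (n0 : (0 < n)%N) (b1 : unorm b <= 1).

Let nR : 0 < n%:R :> R. Proof. by rewrite ltr0n. Qed.
Let nV : 0 <= n%:R^-1 :> R. Proof. by rewrite invr_ge0 ler0n. Qed.

Lemma unorm_fejer : unorm (fejer n b) <= 1.
Proof.
apply: le_trans (unormZr _ nV) _; rewrite mulrC ler_pdivrMr // mulrC.
by apply: unorm_sum_le => j _; apply: unormX_le1.
Qed.

Lemma unorm_fejer_quot : unorm (fejer_quot n b) <= n%:R.
Proof.
apply: le_trans (unormZr _ nV) _; rewrite mulrC ler_pdivrMr //.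
apply: (unorm_sum_le (F := fun j => \sum_(i < j) b ^+ i)) => j jn.
apply: le_trans (unorm_sum_le (c := 1) _) _ => [i _|]; first exact: unormX_le1.
by rewrite mulr1 ler_nat ltnW.
Qed.

Lemma unorm_sub1_mul_fejer : unorm ((1 - b) * fejer n b) <= 2 / n%:R.
Proof.
rewrite sub1_mul_fejer; apply: le_trans (unormZr _ nV) _.
rewrite mulrC ler_wpM2r //; apply: le_trans (unormD _ _) _; rewrite unormN.
by rewrite (_ : 2 = 1 + 1) // lerD // ?unorm1_le // unormX_le1.
Qed.
End FejerMean.

Lemma unorm_unitary_le1 (w : U) : ustar w * w = 1 -> unorm w <= 1.
Proof.
move=> w1; rewrite -(ler_pXn2r (n := 2)) ?nnegrE ?unorm_ge0 ?ler01 //.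
by rewrite -unorm_cstar w1 expr1n unorm1_le.
Qed.

(* With [h] the cosine of the unitary [w], the Fejer mean                     *)
(* [v = (1 - w ^ 2 + w ^ 4 - ...) / n] is a contraction close to the spectral *)
(* projection of [h] on [0], since the sum telescopes against [1 + w ^ 2],    *)
(* which is [2 w h].                                                          *)
Lemma spectral_cutoff (h : A) n : star h = h -> rnorm h <= 2^-1 -> (0 < n)%N ->
  exists v q : U,
    [/\ unorm v <= 1, unorm (inu h * v) <= n%:R^-1, unorm q <= 2 * n%:R,
        1 - v = q * inu h & GRing.comm (inu h) v /\ GRing.comm (inu h) q].
Proof.
move=> hs hn n0; have [w [w1 w2 wh]] := cosine_unitary hs hn.
have wn : unorm w <= 1 by apply: unorm_unitary_le1.
have wsn : unorm (ustar w) <= 1 by rewrite unorm_star.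
have hE : inu h = 2^-1%:C *: (w + ustar w).
  by rewrite wh scalerA -rmorphM /= mulVf ?pnatr_eq0 // rmorph1 scale1r.
have hw : GRing.comm (inu h) w.
  rewrite hE; apply/commr_sym/comm_scale/commrD; first exact: commr_refl.
  by rewrite /GRing.comm w1 w2.
pose b : U := - w ^+ 2.
have hb : GRing.comm (inu h) b by apply/commrN/commrX.
have bn : unorm b <= 1 by rewrite unormN unormX_le1.
have bE : 1 - b = 2%:C *: (w * inu h).
  by rewrite opprK -w2 expr2 -mulrDr addrC wh -scalerAr.
exists (fejer n b), (2%:C *: (fejer_quot n b * w)); split.
- exact: unorm_fejer.
- have -> : inu h * fejer n b = 2^-1%:C *: (ustar w * ((1 - b) * fejer n b)).
    move: (fejer n b) => f.
    rewrite bE -scalerAl -scalerAr scalerA -rmorphM mulVf ?pnatr_eq0 //.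
    by rewrite rmorph1 scale1r !mulrA w1 mul1r.
  apply: le_trans (unormZr _ _) _; first by rewrite invr_ge0.
  have := unormM (ustar w) ((1 - b) * fejer n b).
  have := ler_pM (unorm_ge0 _) (unorm_ge0 _) wsn (unorm_sub1_mul_fejer n bn).
  lra.
- apply: le_trans (unormZr _ _) _; rewrite ?ler_wpM2l //.
  apply: le_trans (unormM _ _) _; rewrite -[leRHS]mulr1.
  by apply: ler_pM; rewrite ?unorm_ge0 //; apply: unorm_fejer_quot.
- by rewrite sub1_fejer // bE; move: (fejer_quot n b) => f; rewrite -scalerAl -scalerAr mulrA.
- split; first exact: comm_fejer.
  by apply/comm_scale/commrM => //; apply: comm_fejer_quot.
Qed.
End SquareRoot.

(** * Quasicentral approximate units *)

Section Ideal.
Variables (R : realType) (A : cstarAlgType R) (I : cstarIdeal A).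
Local Notation U := (unitization A).
Implicit Types m k g u a : U.

Definition uideal m : Prop := (m.1 : R[i]) = 0 /\ m.2 \in I.

Lemma uidealE m : uideal m -> m = inu m.2.
Proof. by case: m => c a [/= -> _]. Qed.

Lemma uideal_inu (a : A) : uideal (inu a) <-> a \in I.
Proof. by split=> [[]|]. Qed.

Lemma uidealD m k : uideal m -> uideal k -> uideal (m + k).
Proof. by move=> [m1 m2] [k1 k2]; split; rewrite /= ?m1 ?k1 ?addr0 ?rpredD. Qed.

Lemma uidealN m : uideal m -> uideal (- m).
Proof. by move=> [m1 m2]; split; rewrite /= ?m1 ?oppr0 ?rpredN. Qed.

Lemma uidealB m k : uideal m -> uideal k -> uideal (m - k).
Proof. by move=> mI kI; apply/uidealD/uidealN. Qed.

Lemma uidealZ c m : uideal m -> uideal (c *: m).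
Proof. by move=> [m1 m2]; split; rewrite /= ?m1 ?scaler0 ?rpredZ. Qed.

Lemma uideal0 : uideal 0.
Proof. by split; rewrite ?rpred0. Qed.

Lemma uidealMl k m : uideal m -> uideal (k * m).
Proof.
move=> /[dup] /uidealE -> [_ mI]; rewrite -inu_lact; apply/uideal_inu.
by rewrite /lact rpredD ?rpredZ // ideal_mull.
Qed.

Lemma uidealMr k m : uideal m -> uideal (m * k).
Proof.
move=> /[dup] /uidealE -> [_ mI]; rewrite -inu_ract; apply/uideal_inu.
by rewrite /ract rpredD ?rpredZ // ideal_mulr.
Qed.

Lemma ideal_limit (a : A) :
  (forall e : R, 0 < e -> exists2 b, b \in I & rnorm (a - b) <= e) -> a \in I.
Proof.
move=> aI; have := @ideal_closed _ _ I; rewrite closure_id => hI.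
suff : [set a : A | a \in I]%classic a by [].
rewrite hI => B /= /nbhs_ballP[e /= e0 Be].
have eE : (complex.Re e)%:C = e by rewrite RRe_real // gtr0_real.
have re2 : 0 < complex.Re e / 2 by rewrite divr_gt0 // -ltcR eE.
have [b bI ab] := aI _ re2; exists b; split=> //.
by apply: Be; rewrite -ball_normE /= -rnormE -eE ltcR; lra.
Qed.

Lemma exists_inv_le (e : R) : 0 < e -> exists2 n, (0 < n)%N & n%:R^-1 <= e.
Proof.
move=> e0; exists (Num.bound e^-1).+1 => //.
rewrite -[leRHS]invrK lef_pV2 ?posrE ?invr_gt0 ?ltr0n //.
apply/ltW/(lt_le_trans (archi_boundP _)); first by rewrite invr_ge0 ltW.
by rewrite ler_nat.
Qed.

(** The square of |v a| is the norm of [v] times [a ** star a] times [ustar v], that is of c h v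
    [ustar v] after commuting, where h v is small. *)
Lemma unorm_cutoff (h a : A) (v : U) (c d : R) :
  0 <= c -> a ** star a = c%:C *: h ->
  unorm v <= 1 -> GRing.comm (inu h) v -> unorm (inu h * v) <= d ->
  unorm (v * inu a) ^+ 2 <= c * d.
Proof.
move=> c0 ah v1 hv hvd; rewrite -unorm_star -unorm_cstar ustarK ustarM.
rewrite mulrA -(mulrA v) ustar_inu -inuM ah inuZ -scalerAr -scalerAl.
apply: le_trans (unormZr _ c0) _; rewrite ler_wpM2l // -hv.
apply: le_trans (unormM _ _) _; rewrite unorm_star -[leRHS]mulr1.
by rewrite ler_pM ?unorm_ge0.
Qed.

(** Cutting off a multiple [h] of g times its adjoint leaves [1 - v] = [q * inu h], which lies in
    the ideal. The adjoint membership is proved separately, from self-adjointness of [h], because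
    stability of the ideal under [star] is only deduced from this lemma. *)
Lemma approx_unit1 g e : uideal g -> 0 < e ->
  exists v, [/\ unorm v <= 1, uideal (1 - v), uideal (1 - ustar v) &
                unorm (v * g) <= e].
Proof.
move=> gI e0; rewrite (uidealE gI); move: (g.2) (proj2 gI) => {gI}g gI.
(* Normalizes [h] to norm at most 1/2, as [spectral_cutoff] demands; adding 1 keeps [c] positive
   when [g] is 0. *)
pose c : R := 2 * rnorm g ^+ 2 + 1.
have g2 : 0 <= rnorm g ^+ 2 by rewrite exprn_ge0 // rnorm_ge0.
have c0 : 0 < c by rewrite /c; lra.
pose h := c^-1%:C *: (g ** star g).
have hE : g ** star g = c%:C *: h by rewrite real_scaleK // gt_eqF.
have hs : star h = h by rewrite starZr starM starK.
have hn : rnorm h <= 2^-1.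
  rewrite rnormZr rnorm_cstarr ger0_norm ?invr_ge0 ?(ltW c0) //.
  by rewrite ler_pdivrMl // /c; lra.
have hI : uideal (inu h).
  by apply/uideal_inu; rewrite rpredZ // ideal_mulr.
have ec : 0 < e ^+ 2 / c by rewrite divr_gt0 // exprn_gt0.
have [n n0 ne] := exists_inv_le ec.
have [v [q [v1 hv _ vq [hvc _]]]] := spectral_cutoff hs hn n0.
have vI : uideal (1 - v) by rewrite vq; apply: uidealMl.
have hus : ustar (inu h) = inu h by rewrite ustar_inu hs.
exists v; split=> //.
  by rewrite -{1}[1](ustar1 A) -ustarB vq ustarM hus; apply: uidealMr.
rewrite -(ler_pXn2r (n := 2)) ?nnegrE ?unorm_ge0 ?(ltW e0) //.
have := unorm_cutoff (ltW c0) hE v1 hvc (le_trans hv ne).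
by rewrite mulrCA divff ?mulr1 // gt_eqF.
Qed.

(** If v a is small, then [star a] is close to its product with [1 - ustar v] on the right, which
    lies in [I] because that factor does. *)
Lemma ideal_star (a : A) : a \in I -> star a \in I.
Proof.
move=> aI; apply: ideal_limit => e e0.
have [v [_ _ vI ve]] := approx_unit1 (proj2 (uideal_inu a) aI) e0.
exists (ract (star a) (1 - ustar v)).
  by apply/uideal_inu; rewrite inu_ract; apply: uidealMl.
rewrite -unorm_inu inuB inu_ract mulrBr mulr1 opprB addrCA subrr addr0.
by rewrite -ustar_inu -ustarM unorm_star.
Qed.

Lemma uideal_star m : uideal m -> uideal (ustar m).
Proof.
by move=> /[dup] /uidealE -> [_ mI]; rewrite ustar_inu; apply/uideal_inu/ideal_star.
Qed.

(** Each new factor [k] is chosen for [v * g] and put on the left; being a contraction, it preserves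
    the smallness already obtained. *)
Lemma approx_unit_seq (G : seq U) e : (forall g, g \in G -> uideal g) -> 0 < e ->
  exists v, [/\ unorm v <= 1, uideal (1 - v) &
                forall g, g \in G -> unorm (v * g) <= e].
Proof.
elim: G => [|g G IH] GI e0.
  by exists 1; split=> //; rewrite ?unorm1_le // subrr; apply: uideal0.
have [|v [v1 vI vG]] := IH _ e0.
  by move=> k kG; apply: GI; rewrite inE kG orbT.
have gI : uideal g by apply: GI; rewrite mem_head.
have [k [k1 kI _ kv]] := approx_unit1 (uidealMl v gI) e0.
exists (k * v); split.
- by apply: le_trans (unormM _ _) _; rewrite mulr_ile1 ?unorm_ge0.
- have -> : 1 - k * v = (1 - k) * v + (1 - v) by rewrite mulrBl mul1r [RHS]addrC addrA subrK.
  by apply: uidealD => //; apply: uidealMr.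
- move=> m; rewrite inE -mulrA => /predU1P[->//|mG].
  apply: le_trans (unormM _ _) _; rewrite -[leRHS]mul1r.
  by rewrite ler_pM ?unorm_ge0 ?vG.
Qed.

(** Passing from [v] to [ustar v * v] makes [u] self-adjoint and keeps [1 - u] a contraction. *)
Lemma approx_unit (G : seq U) e : (forall g, g \in G -> uideal g) -> 0 < e ->
  exists u, [/\ uideal u, ustar u = u, unorm (1 - u) <= 1 &
                forall g, g \in G -> unorm (g - u * g) <= e].
Proof.
move=> GI e0; have [v [v1 vI vG]] := approx_unit_seq GI e0.
have vsI := uideal_star vI; rewrite ustarB ustar1 in vsI.
exists (1 - ustar v * v); split.
- have -> : 1 - ustar v * v = (1 - ustar v) * v + (1 - v).
    by rewrite mulrBl mul1r [RHS]addrC addrA subrK.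
  by apply: uidealD => //; apply: uidealMr.
- by rewrite ustarB ustar1 ustarM ustarK.
- by rewrite opprB addrC subrK unorm_cstar expr_le1 ?unorm_ge0.
- move=> g gG; rewrite mulrBl mul1r opprB addrC subrK -mulrA.
  apply: le_trans (unormM _ _) _; rewrite unorm_star -[leRHS]mul1r.
  by rewrite ler_pM ?unorm_ge0 ?vG.
Qed.

Definition commutator m k : U := m * k - k * m.

(* The successive approximate units are chosen so that the commutators with   *)
(* each [a] are almost orthogonal: those of a later one, multiplied by an     *)
(* earlier one [g], give [u (a^* g) - a^* (u g)], which is almost 0. Hence    *)
(* the commutator of the sum of [n] of them only grows like [sqrt n].         *)
Lemma quasicentral_sum (F G : seq U) (B e : R) (n : nat) :
  (forall g, g \in G -> uideal g) -> 0 < e -> 0 <= B ->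
  (forall a, a \in F -> unorm a <= B) ->
  exists s, [/\ uideal s, ustar s = s, unorm (n%:R - s) <= n%:R,
     forall a, a \in F -> unorm (commutator a s) ^+ 2 <= n%:R * (16 * B ^+ 2 + 1) &
     forall g, g \in G -> unorm (n%:R * g - s * g) <= n%:R * e].
Proof.
move=> GI e0 B0 FB; elim: n => [|n [s [sI ss s1 sF sG]]].
  exists 0; split; rewrite ?subr0 ?unorm0 //; first exact: uideal0.
  - by have := ustarB (0 : U) 0; rewrite !subrr.
  - by move=> a _; rewrite /commutator mulr0 mul0r subrr unorm0 expr0n mul0r.
  - by move=> g _; rewrite !mul0r subrr unorm0.
(* The cross term is at most d (1 + B), so this choice bounds it by 1/2. Its two occurrences give
   the 1 in [16 * B ^+ 2 + 1]; the square of |D| <= 4 B gives the rest. *)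
pose d := Num.min e (2 * (1 + B))^-1.
have d0 : 0 < d by rewrite lt_min e0 invr_gt0; lra.
have csI a : uideal (commutator a s) by apply: uidealB; [apply: uidealMl|apply: uidealMr].
pose H := G ++ [seq commutator a s | a <- F] ++ [seq ustar a * commutator a s | a <- F].
have HI g : g \in H -> uideal g.
  rewrite !mem_cat => /or3P[/GI//|/mapP[a _ ->]//|/mapP[a _ ->]].
  exact/uidealMl/csI.
have [u [uI us u1 uH]] := approx_unit HI d0.
have u2 : unorm u <= 2.
  rewrite -[u](subKr 1); apply: le_trans (unormD _ _) _; rewrite unormN.
  by rewrite (_ : 2 = 1 + 1) // lerD // unorm1_le.
exists (s + u); split.
- exact: uidealD.
- by rewrite ustarD ss us.
- rewrite -natr1 opprD addrACA; apply: le_trans (unormD _ _) _.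
  by rewrite -natr1 lerD.
- move=> a aF; have aB := FB a aF.
  have DSE k : ustar (commutator a u) * k =
      ustar a * (k - u * k) - (ustar a * k - u * (ustar a * k)).
    rewrite /commutator ustarB !ustarM us mulrBl mulrBr !mulrA opprB.
    by rewrite [RHS]addrC addrA subrK.
  set S := commutator a s; set D := commutator a u.
  have -> : commutator a (s + u) = S + D.
    by rewrite /commutator mulrDr mulrDl opprD addrACA.
  have Dn : unorm D <= 4 * B.
    apply: le_trans (unormD _ _) _; rewrite unormN.
    have := unormM a u; have := unormM u a.
    have := ler_pM (unorm_ge0 _) (unorm_ge0 _) aB u2.
    rewrite (mulrC (unorm a)); lra.
  have Dn2 : unorm D ^+ 2 <= 16 * B ^+ 2.
    have -> : 16 * B ^+ 2 = (4 * B) ^+ 2 by rewrite exprMn; congr (_ * _); ring.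
    by rewrite ler_sqr ?nnegrE ?unorm_ge0 // mulr_ge0.
  have DS : unorm (ustar D * S) <= 2^-1.
    rewrite DSE.
    apply: le_trans (unormD _ _) _; rewrite unormN.
    have h1 : unorm (S - u * S) <= d.
      by apply: uH; rewrite !mem_cat (map_f (commutator^~ s) aF) ?orbT.
    have h2 : unorm (ustar a * S - u * (ustar a * S)) <= d.
      by apply: uH; rewrite !mem_cat (map_f (fun a => ustar a * commutator a s) aF) !orbT.
    have := unormM (ustar a) (S - u * S); rewrite unorm_star.
    have := ler_pM (unorm_ge0 _) (unorm_ge0 _) aB h1.
    have : d * (2 * (1 + B)) <= 1.
      by rewrite -ler_pdivlMr ?mul1r ?ge_min ?lexx ?orbT //; lra.
    move: h1 h2; nra.
  have SD : unorm (ustar S * D) = unorm (ustar D * S).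
    by rewrite -unorm_star ustarM ustarK.
  rewrite -unorm_cstar ustarD mulrDr !mulrDl.
  have := unormD (ustar S * S + ustar D * S) (ustar S * D + ustar D * D).
  have := unormD (ustar S * S) (ustar D * S).
  have := unormD (ustar S * D) (ustar D * D).
  rewrite SD !unorm_cstar; have := sF a aF; rewrite -/S -natr1.
  move: (unorm S ^+ 2) (unorm D ^+ 2) (B ^+ 2) Dn2 DS => x y z; nra.
- move=> g gG; rewrite -natr1 !mulrDl mul1r opprD addrACA.
  apply: le_trans (unormD _ _) _; rewrite -natr1 mulrDl mul1r lerD ?sG //.
  have := uH g; rewrite mem_cat gG => /(_ isT) /le_trans; apply.
  by rewrite ge_min lexx.
Qed.

(** Divide the sum of [n] approximate units by [n]: the commutators, of order sqrt n before, become
    of order 1 / sqrt n, while the other estimates are preserved by averaging. *)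
Lemma quasicentral_unit (F G : seq U) (e : R) :
  (forall g, g \in G -> uideal g) -> 0 < e ->
  exists u, [/\ uideal u, ustar u = u, unorm (1 - u) <= 1,
     forall a, a \in F -> unorm (a * u - u * a) <= e &
     forall g, g \in G -> unorm (g - u * g) <= e].
Proof.
move=> GI e0; pose B := \sum_(a <- F) unorm a.
have B0 : 0 <= B by apply: sumr_ge0 => a _; apply: unorm_ge0.
have FB a : a \in F -> unorm a <= B.
  move=> aF; rewrite /B (big_rem a) //= lerDl.
  by apply: sumr_ge0 => k _; apply: unorm_ge0.
pose C := 16 * B ^+ 2 + 1.
have C0 : 0 < C by rewrite /C; have := sqr_ge0 B; lra.
have eC : 0 < e ^+ 2 / C by rewrite divr_gt0 // exprn_gt0.
have [n n0 ne] := exists_inv_le eC.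
have nR : 0 < n%:R :> R by rewrite ltr0n.
have nV : 0 <= n%:R^-1 :> R by rewrite invr_ge0 ltW.
have nn : n%:R != 0 :> R by rewrite gt_eqF.
have [s [sI ss s1 sF sG]] := quasicentral_sum n GI e0 B0 FB.
have nE (m : U) : m = n%:R^-1%:C *: (n%:R * m).
  have -> : n%:R * m = n%:R%:C *: m by rewrite rmorph_nat scaler_nat mulr_natl.
  by rewrite scalerA -rmorphM mulVf // rmorph1 scale1r.
exists (n%:R^-1%:C *: s); split.
- exact: uidealZ.
- by rewrite ustarZr ss.
- rewrite (nE 1) mulr1 -scalerBr; apply: le_trans (unormZr _ nV) _.
  by rewrite ler_pdivrMl // mulr1.
- move=> a aF; rewrite -scalerAr -scalerAl -scalerBr.
  apply: le_trans (unormZr _ nV) _.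
  rewrite -(ler_pXn2r (n := 2)) ?nnegrE ?mulr_ge0 ?unorm_ge0 ?(ltW e0) //.
  rewrite exprMn; apply: le_trans (ler_wpM2l _ (sF a aF)) _.
    by rewrite exprn_ge0.
  by rewrite -/C expr2 -mulrA mulKf // -ler_pdivlMr.
- move=> g gG; rewrite (nE g) -scalerAl -scalerBr -nE.
  apply: le_trans (unormZr _ nV) _.
  by rewrite ler_pdivrMl // sG.
Qed.

Definition qc_set (i : seq U * seq U * R) : set U :=
  [set u | [/\ uideal u, ustar u = u, unorm (1 - u) <= 1,
     forall a, a \in i.1.1 -> unorm (a * u - u * a) <= i.2 &
     forall g, g \in i.1.2 -> unorm (g - u * g) <= i.2]]%classic.

Definition qc_index : set (seq U * seq U * R) :=
  [set i : seq U * seq U * R | (forall g, g \in i.1.2 -> uideal g) /\ 0 < i.2]%classic.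

(** A filter in place of a net: finitely many requirements on [u] can be imposed one at a time and
    then met together. *)
Definition quasicentral : set_system U := filter_from qc_index qc_set.

Global Instance quasicentral_filter : ProperFilter quasicentral.
Proof.
apply: filter_from_proper.
  apply: filter_from_filter.
    by exists ([::], [::], 1); split=> //=; rewrite ltr01.
  move=> [[F G] e] [[F' G'] e'] [/= GI e0] [/= GI' e0'].
  exists (F ++ F', G ++ G', Num.min e e').
    split=> [g|] /=; last by rewrite lt_min e0.
    by rewrite mem_cat => /orP[/GI|/GI'].
  move=> u [/= uI us u1 uF uG].
  split; split=> //= a aF.
  - by have := uF a; rewrite mem_cat aF le_min => /(_ isT)/andP[].
  - by have := uG a; rewrite mem_cat aF le_min => /(_ isT)/andP[].
  - by have := uF a; rewrite mem_cat aF orbT le_min => /(_ isT)/andP[].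
  - by have := uG a; rewrite mem_cat aF orbT le_min => /(_ isT)/andP[].
move=> [[F G] e] [/= GI e0]; have [u hu] := quasicentral_unit F GI e0.
by exists u.
Qed.

Lemma near_quasicentral_ideal : \forall u \near quasicentral,
  [/\ uideal u, ustar u = u & unorm (1 - u) <= 1].
Proof.
exists ([::], [::], 1); first by split=> //=; rewrite ltr01.
by move=> u [].
Qed.

Lemma near_quasicentral_comm m (e : R) : 0 < e ->
  \forall u \near quasicentral, unorm (m * u - u * m) <= e.
Proof.
move=> e0; exists ([:: m], [::], e) => // u [_ _ _ um _].
by apply: um; rewrite mem_head.
Qed.

Lemma near_quasicentral_unit g (e : R) : uideal g -> 0 < e ->
  \forall u \near quasicentral, unorm (g - u * g) <= e.
Proof.
move=> gI e0; exists ([::], [:: g], e).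
  by split=> // k; rewrite inE => /eqP->.
by move=> u [_ _ _ _ ug]; apply: ug; rewrite mem_head.
Qed.

End Ideal.

(** * Calculus modulo functions vanishing along the approximate unit *)

Section AsymptoticEquality.
Variables (R : realType) (A : cstarAlgType R).
Local Notation U := (unitization A).
Variables (T : Type) (F : set_system T).
Context {FF : Filter F}.
Implicit Types f g h : T -> U.

Definition bounded_along f : Prop := exists B, \forall u \near F, unorm (f u) <= B.

(** For bounded functions this is equality in the quotient algebra by the functions tending to 0
    along [F]; boundedness is needed for compatibility with products. *)
Definition asymp_eq f g : Prop :=
  forall e : R, 0 < e -> \forall u \near F, unorm (f u - g u) <= e.

Lemma asymp_near_eq f g : (\forall u \near F, f u = g u) -> asymp_eq f g.
Proof.
by move=> fg e e0; apply: filterS fg => u ->; rewrite subrr unorm0 ltW.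
Qed.

Lemma asymp_refl f : asymp_eq f f.
Proof. by apply: asymp_near_eq; apply: nearW. Qed.

Lemma asymp_sym f g : asymp_eq f g -> asymp_eq g f.
Proof. by move=> fg e /fg; apply: filterS => u; rewrite unormB. Qed.

Lemma asymp_trans g f h : asymp_eq f g -> asymp_eq g h -> asymp_eq f h.
Proof.
move=> fg gh e e0; have e2 : 0 < e / 2 by rewrite divr_gt0.
apply: filterS2 (fg _ e2) (gh _ e2) => u h1 h2.
have := unorm_tri (g u) (f u) (h u); lra.
Qed.

Lemma bounded_asymp f g : asymp_eq f g -> bounded_along g -> bounded_along f.
Proof.
move=> fg [B gB]; exists (1 + B).
apply: filterS2 (fg _ ltr01) gB => u h1 h2.
have := unormD (f u - g u) (g u); rewrite subrK; lra.
Qed.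

Lemma bounded_cst k : bounded_along (fun=> k).
Proof. by exists (unorm k); apply: nearW. Qed.

Lemma bounded_mul f g : bounded_along f -> bounded_along g ->
  bounded_along (fun u => f u * g u).
Proof.
move=> [B fB] [C gC]; exists (B * C); apply: filterS2 fB gC => u h1 h2.
by apply: le_trans (unormM _ _) _; rewrite ler_pM ?unorm_ge0.
Qed.

Lemma asymp_add f g f' g' : asymp_eq f f' -> asymp_eq g g' ->
  asymp_eq (fun u => f u + g u) (fun u => f' u + g' u).
Proof.
move=> ff gg e e0; have e2 : 0 < e / 2 by rewrite divr_gt0.
apply: filterS2 (ff _ e2) (gg _ e2) => u h1 h2.
have := unormD (f u - f' u) (g u - g' u); rewrite addrACA -opprD; lra.
Qed.

Lemma asymp_scale c f g : asymp_eq f g ->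
  asymp_eq (fun u => c *: f u) (fun u => c *: g u).
Proof.
move=> fg e e0; have c0 : 0 <= complex.Re `|c| := rnorm_ge0 (c : R[i]^o).
have e2 : 0 < e / (1 + complex.Re `|c|) by rewrite divr_gt0 //; lra.
apply: filterS (fg _ e2) => u h1; rewrite -scalerBr.
apply: le_trans (unormZ _ _) _.
rewrite ler_pdivlMr in h1; last lra.
have := unorm_ge0 (f u - g u); move: h1 c0.
set x := unorm _; set y := complex.Re _; nra.
Qed.

Lemma asymp_opp f g : asymp_eq f g -> asymp_eq (fun u => - f u) (fun u => - g u).
Proof. by move=> fg e /fg; apply: filterS => u; rewrite -opprD unormN. Qed.

Lemma asymp_sub f g f' g' : asymp_eq f f' -> asymp_eq g g' ->
  asymp_eq (fun u => f u - g u) (fun u => f' u - g' u).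
Proof. by move=> ff gg; apply: asymp_add => //; apply: asymp_opp. Qed.

Lemma asymp_mull h f g : bounded_along h -> asymp_eq f g ->
  asymp_eq (fun u => h u * f u) (fun u => h u * g u).
Proof.
move=> [B hB] fg e e0; have B0 : 0 <= `|B| by [].
have e2 : 0 < e / (1 + `|B|) by rewrite divr_gt0 //; lra.
apply: filterS2 hB (fg _ e2) => u h1 h2; rewrite -mulrBr.
apply: le_trans (unormM _ _) _.
rewrite ler_pdivlMr in h2; last lra.
have := unorm_ge0 (f u - g u); have := ler_norm B; move: h1 h2 B0.
move: (unorm (h u)) (unorm _) `|B| => x y z; nra.
Qed.

Lemma asymp_mulr h f g : bounded_along h -> asymp_eq f g ->
  asymp_eq (fun u => f u * h u) (fun u => g u * h u).
Proof.
move=> [B hB] fg e e0; have B0 : 0 <= `|B| by [].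
have e2 : 0 < e / (1 + `|B|) by rewrite divr_gt0 //; lra.
apply: filterS2 hB (fg _ e2) => u h1 h2; rewrite -mulrBl.
apply: le_trans (unormM _ _) _.
rewrite ler_pdivlMr in h2; last lra.
have := unorm_ge0 (f u - g u); have := ler_norm B; move: h1 h2 B0.
move: (unorm (h u)) (unorm _) `|B| => x y z; nra.
Qed.

Lemma asymp_mul f g f' g' : bounded_along f' -> bounded_along g' ->
  asymp_eq f f' -> asymp_eq g g' ->
  asymp_eq (fun u => f u * g u) (fun u => f' u * g' u).
Proof.
move=> bf bg ff gg; apply: (@asymp_trans (fun u => f u * g' u)).
  by apply: asymp_mull => //; apply: bounded_asymp ff bf.
exact: asymp_mulr.
Qed.

Lemma asymp_star f g : asymp_eq f g ->
  asymp_eq (fun u => ustar (f u)) (fun u => ustar (g u)).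
Proof. by move=> fg e /fg; apply: filterS => u; rewrite -ustarB unorm_star. Qed.

Lemma asymp_sum (J : eqType) (s : seq J) (f g : J -> T -> U) :
  (forall j, j \in s -> asymp_eq (f j) (g j)) ->
  asymp_eq (fun u => \sum_(j <- s) f j u) (fun u => \sum_(j <- s) g j u).
Proof.
elim: s => [|j s IH] fg.
  by apply: asymp_near_eq; apply: nearW => u; rewrite !big_nil.
apply: (@asymp_trans (fun u => f j u + \sum_(j <- s) f j u)).
  by apply: asymp_near_eq; apply: nearW => u; rewrite big_cons.
apply: (@asymp_trans (fun u => g j u + \sum_(j <- s) g j u)).
  apply: asymp_add; first by apply: fg; rewrite mem_head.
  by apply: IH => i si; apply: fg; rewrite inE si orbT.
by apply: asymp_near_eq; apply: nearW => u; rewrite big_cons.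
Qed.

Lemma asymp_unorm_le f g B e : asymp_eq f g -> (\forall u \near F, unorm (g u) <= B) ->
  0 < e -> \forall u \near F, unorm (f u) <= B + e.
Proof.
move=> fg gB e0; apply: filterS2 (fg _ e0) gB => u h1 h2.
have := unormD (f u - g u) (g u); rewrite subrK; lra.
Qed.

End AsymptoticEquality.

Lemma bernoulli (R : realFieldType) (x : R) n : 0 <= x -> 1 + n%:R * x <= (1 + x) ^+ n.
Proof.
move=> x0; elim: n => [|n IH]; first by rewrite mul0r addr0.
have nx : 0 <= n%:R * x * x by rewrite !mulr_ge0.
rewrite exprS -natr1; apply: le_trans (ler_wpM2l _ IH); lra.
Qed.

(** By Bernoulli the powers of 1 + e/B are unbounded, so any constant factor disappears after a high
    root. *)
Lemma exists_exp_le (R : realType) (c B e : R) : 0 < B -> 0 < e ->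
  exists j, c * B ^+ (2 ^ j) <= (B + e) ^+ (2 ^ j).
Proof.
move=> B0 e0; exists (Num.bound (c * B / e)); set j := Num.bound _.
have eB : 0 <= e / B by rewrite divr_ge0 ?ltW.
have -> : B + e = B * (1 + e / B) by rewrite mulrDr mulr1 mulrCA divff ?mulr1 // gt_eqF.
rewrite exprMn mulrC ler_wpM2l ?exprn_ge0 ?(ltW B0) //.
apply: le_trans (bernoulli _ eB).
have : c * B / e <= (2 ^ j)%:R by rewrite natrX; apply/ltW/upper_nthrootP.
by rewrite ler_pdivrMr // -ler_pdivlMr // -mulrA => h; lra.
Qed.

(** * Damping along the quasicentral approximate unit *)

Section IdealAbsorption.
Variables (R : realType) (A : cstarAlgType R) (I : cstarIdeal A).
Local Notation U := (unitization A).
Local Notation F := (quasicentral I).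
Local Notation "f ~~ g" := (asymp_eq F f g) (at level 70).
Implicit Types (u g : U).

Lemma bounded_quasicentral : bounded_along F (fun u => u).
Proof.
exists 2; apply: filterS (near_quasicentral_ideal I) => u [_ _ u1].
have := unorm_tri 1 u 0; rewrite !subr0 unormB; have := unorm1_le A; lra.
Qed.

Lemma asymp_ideal_l g : uideal I g -> (fun u => u * g) ~~ (fun=> g).
Proof.
by move=> gI; apply: asymp_sym => e; apply: near_quasicentral_unit.
Qed.

Lemma asymp_ideal_r g : uideal I g -> (fun u => g * u) ~~ (fun=> g).
Proof.
move=> gI; apply: (@asymp_trans _ _ _ _ _ (fun u => ustar (u * ustar g))).
  apply: asymp_near_eq; apply: filterS (near_quasicentral_ideal I) => u [_ us _].
  by rewrite ustarM ustarK us.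
rewrite -[g in X in _ ~~ X]ustarK; apply: asymp_star.
exact/asymp_ideal_l/uideal_star.
Qed.

Lemma asymp_ideal_lr g : uideal I g -> (fun u => u * g * u) ~~ (fun=> g).
Proof.
move=> gI; apply: asymp_trans (asymp_ideal_r gI).
by apply: asymp_mulr; [apply: bounded_quasicentral|apply: asymp_ideal_l].
Qed.

End IdealAbsorption.

Section Damping.
Variables (R : realType) (A : cstarAlgType R) (I : cstarIdeal A) (t : R).
Hypothesis t01 : 0 <= t <= 1.
Local Notation U := (unitization A).
Local Notation F := (quasicentral I).
Local Notation "f ~~ g" := (asymp_eq F f g) (at level 70).
Implicit Types (u m g : U) (k : nat).

Definition damp u : U := 1 - t%:C *: u.

(** [damp u] is a convex combination of the contractions 1 and [1 - u]. *)
Lemma near_unorm_damp : \forall u \near F, unorm (damp u) <= 1.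
Proof.
apply: filterS (near_quasicentral_ideal I) => u [_ _ u1].
have /andP[t0 t1] := t01.
have -> : damp u = (1 - t)%:C *: 1 + t%:C *: (1 - u).
  by rewrite rmorphB rmorph1 scalerBl scale1r scalerBr addrA subrK.
apply: le_trans (unormD _ _) _.
have := unormZr (1 - u) t0.
have := @unormZr _ A (1 - t) 1; rewrite subr_ge0 => /(_ t1).
have := unorm1_le A; have := unorm_ge0 (1 : U); have := unorm_ge0 (1 - u).
nra.
Qed.

Lemma near_damp_star : \forall u \near F, ustar (damp u) = damp u.
Proof.
apply: filterS (near_quasicentral_ideal I) => u [_ us _].
by rewrite ustarB ustar1 ustarZr us.
Qed.

Lemma near_unorm_dampX k : \forall u \near F, unorm (damp u ^+ k) <= 1.
Proof. by apply: filterS near_unorm_damp => u; apply: unormX_le1. Qed.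

Lemma bounded_dampX k : bounded_along F (fun u => damp u ^+ k).
Proof. by exists 1; apply: near_unorm_dampX. Qed.

Lemma bounded_dampX_mul k m : bounded_along F (fun u => damp u ^+ k * m).
Proof. by apply: bounded_mul; [apply: bounded_dampX|apply: bounded_cst]. Qed.

Lemma asymp_comm m : (fun u => m * u) ~~ (fun u => u * m).
Proof. by move=> e; apply: near_quasicentral_comm. Qed.

Lemma asymp_damp_comm m : (fun u => m * damp u) ~~ (fun u => damp u * m).
Proof.
apply: (@asymp_trans _ _ _ _ _ (fun u => m - t%:C *: (m * u))).
  by apply: asymp_near_eq; apply: nearW => u; rewrite mulrBr mulr1 scalerAr.
apply: (@asymp_trans _ _ _ _ _ (fun u => m - t%:C *: (u * m))).
  apply: asymp_sub; first exact: asymp_refl.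
  by apply: asymp_scale; apply: asymp_comm.
by apply: asymp_near_eq; apply: nearW => u; rewrite mulrBl mul1r scalerAl.
Qed.

Lemma asymp_dampX_comm m k : (fun u => m * damp u ^+ k) ~~ (fun u => damp u ^+ k * m).
Proof.
elim: k => [|k IH].
  by apply: asymp_near_eq; apply: nearW => u; rewrite mulr1 mul1r.
apply: (@asymp_trans _ _ _ _ _ (fun u => damp u ^+ k * (m * damp u))).
  apply: (@asymp_trans _ _ _ _ _ (fun u => m * damp u ^+ k * damp u)).
    by apply: asymp_near_eq; apply: nearW => u; rewrite exprSr mulrA.
  apply: (@asymp_trans _ _ _ _ _ (fun u => damp u ^+ k * m * damp u)).
    by apply: asymp_mulr => //; exists 1; apply: near_unorm_damp.
  by apply: asymp_near_eq; apply: nearW => u; rewrite mulrA.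
apply: (@asymp_trans _ _ _ _ _ (fun u => damp u ^+ k * (damp u * m))).
  by apply: asymp_mull; [apply: bounded_dampX|apply: asymp_damp_comm].
by apply: asymp_near_eq; apply: nearW => u; rewrite exprSr mulrA.
Qed.

(** On the ideal [u] acts asymptotically as 1, so each [damp u] acts as the scalar [1 - t]. *)
Lemma asymp_dampX_ideal g k : uideal I g ->
  (fun u => damp u ^+ k * g) ~~ (fun=> (1 - t)%:C ^+ k *: g).
Proof.
move=> gI; elim: k => [|k IH].
  by apply: asymp_near_eq; apply: nearW => u; rewrite mul1r scale1r.
apply: (@asymp_trans _ _ _ _ _ (fun u => damp u ^+ k * ((1 - t)%:C *: g))).
  apply: (@asymp_trans _ _ _ _ _ (fun u => damp u ^+ k * (damp u * g))).
    by apply: asymp_near_eq; apply: nearW => u; rewrite exprSr mulrA.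
  apply: asymp_mull; first exact: bounded_dampX.
  apply: (@asymp_trans _ _ _ _ _ (fun u => g - t%:C *: (u * g))).
    by apply: asymp_near_eq; apply: nearW => u; rewrite mulrBl mul1r scalerAl.
  apply: (@asymp_trans _ _ _ _ _ (fun u => g - t%:C *: g)).
    apply: asymp_sub; first exact: asymp_refl.
    by apply: asymp_scale; apply: asymp_sym => e; apply: near_quasicentral_unit.
  apply: asymp_near_eq; apply: nearW => u.
  by rewrite rmorphB rmorph1 scalerBl scale1r.
apply: (@asymp_trans _ _ _ _ _ (fun u => (1 - t)%:C *: (damp u ^+ k * g))).
  by apply: asymp_near_eq; apply: nearW => u; rewrite scalerAr.
apply: (@asymp_trans _ _ _ _ _ (fun=> (1 - t)%:C *: ((1 - t)%:C ^+ k *: g))).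
  exact: asymp_scale.
by apply: asymp_near_eq; apply: nearW => u; rewrite scalerA -exprS.
Qed.

Lemma asymp_damp_mul m m' k k' :
  (fun u => (damp u ^+ k * m) * (damp u ^+ k' * m')) ~~
  (fun u => damp u ^+ (k + k') * (m * m')).
Proof.
apply: (@asymp_trans _ _ _ _ _ (fun u => damp u ^+ k * (m * damp u ^+ k') * m')).
  by apply: asymp_near_eq; apply: nearW => u; rewrite !mulrA.
apply: (@asymp_trans _ _ _ _ _ (fun u => damp u ^+ k * (damp u ^+ k' * m) * m')).
  apply: asymp_mulr; first exact: bounded_cst.
  by apply: asymp_mull; [apply: bounded_dampX|apply: asymp_dampX_comm].
by apply: asymp_near_eq; apply: nearW => u; rewrite exprD !mulrA.
Qed.

Lemma asymp_damp_star m k :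
  (fun u => ustar (damp u ^+ k * m)) ~~ (fun u => damp u ^+ k * ustar m).
Proof.
apply: asymp_trans (asymp_dampX_comm (ustar m) k).
apply: asymp_near_eq; apply: filterS near_damp_star => u us.
by rewrite ustarM ustarX us.
Qed.

(* Power trick: for [N = 2 ^ j], the N-th power of the norm is the norm of    *)
(* [iter j sq (damp u ^+ k * a)], which is almost [damp u ^+ (k * N)] times   *)
(* [iter j sq a]; comparing [a] with [c] modulo the ideal bounds the latter   *)
(* by [3 B ^ N], and N-th roots remove the constant.                          *)
Lemma near_damp_mul_le (a c : U) k (B e : R) : (0 < k)%N -> 0 < B -> 0 < e ->
  uideal I (a - c) -> unorm c <= B -> (1 - t) * unorm a <= B ->
  \forall u \near F, unorm (damp u ^+ k * a) <= B + e.
Proof.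
move=> k0 B0 e0 acI cB aB; have /andP[t0 t1] := t01.
pose sq (m : U) := ustar m * m.
have sqn j m : unorm (iter j sq m) = unorm m ^+ (2 ^ j).
  by elim: j => [|j IH] //=; rewrite unorm_cstar IH -exprM expnSr.
have sqI j : uideal I (iter j sq a - iter j sq c).
  elim: j => [|j IH] //=; set x := iter j sq a; set y := iter j sq c.
  have -> : sq x - sq y = ustar x * (x - y) + ustar (x - y) * y.
    by rewrite ustarB mulrBr mulrBl addrA subrK.
  by apply: uidealD; [apply: uidealMl|apply/uidealMr/uideal_star].
have sqd j : (fun u => iter j sq (damp u ^+ k * a)) ~~
             (fun u => damp u ^+ (k * 2 ^ j) * iter j sq a).
  elim: j => [|j IH] /=; first by rewrite expn0 muln1; apply: asymp_refl.
  apply: asymp_trans (_ : _ ~~ (fun u => (damp u ^+ (k * 2 ^ j) * ustar (iter j sq a)) *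
     (damp u ^+ (k * 2 ^ j) * iter j sq a))) _.
    apply: asymp_mul => //; try exact: bounded_dampX_mul.
    exact: asymp_trans (asymp_star IH) (asymp_damp_star _ _).
  apply: asymp_trans (asymp_damp_mul _ _ _ _) _.
  by rewrite addnn -mul2n mulnCA -expnS; apply: asymp_refl.
have [j hj] : exists j, 4 * B ^+ (2 ^ j) <= (B + e) ^+ (2 ^ j).
  by have [j] := exists_exp_le 4 B0 e0; exists j.
have s0 : 0 <= 1 - t by lra.
have aj : (1 - t) ^+ (k * 2 ^ j) * unorm a ^+ (2 ^ j) <= B ^+ (2 ^ j).
  rewrite exprM -exprMn lerXn2r ?nnegrE ?mulr_ge0 ?exprn_ge0 ?unorm_ge0 ?(ltW B0) //.
  apply: le_trans aB; rewrite ler_wpM2r ?unorm_ge0 //.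
  by rewrite -[leRHS]expr1 ler_wiXn2l //; lra.
have cj : unorm (iter j sq c) <= B ^+ (2 ^ j).
  by rewrite sqn lerXn2r ?nnegrE ?unorm_ge0 // ltW.
(* The part from [c] contributes one B^N; the difference lies in the ideal, so damping scales it by
   s and it contributes at most two more. The fourth is the slack of the asymptotic estimate. *)
have main : \forall u \near F, unorm (iter j sq (damp u ^+ k * a)) <=
    3 * B ^+ (2 ^ j) + B ^+ (2 ^ j).
  pose K := (k * 2 ^ j)%N; pose s := (1 - t)%:C ^+ K.
  apply: (@asymp_unorm_le _ _ _ _ _ _ (fun u => damp u ^+ K * iter j sq c +
     s *: (iter j sq a - iter j sq c))).
  - apply: asymp_trans (sqd j) _.
    apply: asymp_trans (_ : _ ~~ (fun u => damp u ^+ K * iter j sq c +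
       damp u ^+ K * (iter j sq a - iter j sq c))) _.
      apply: asymp_near_eq; apply: nearW => u.
      by rewrite -mulrDr addrC subrK.
    apply: asymp_add; first exact: asymp_refl.
    exact: asymp_dampX_ideal.
  - apply: filterS (near_unorm_dampX K) => u uK.
    have sE : s = ((1 - t) ^+ K)%:C by rewrite rmorphXn.
    have sK : 0 <= (1 - t) ^+ K by rewrite exprn_ge0.
    have sK1 : (1 - t) ^+ K <= 1 by rewrite exprn_ile1 //; lra.
    have h1 := unormZr (iter j sq a - iter j sq c) sK; rewrite -sE in h1.
    have h2 := unormD (iter j sq a) (- iter j sq c); rewrite unormN in h2.
    have h3 := unormD (damp u ^+ K * iter j sq c) (s *: (iter j sq a - iter j sq c)).
    have h4 := unormM (damp u ^+ K) (iter j sq c).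
    have h5 := unorm_ge0 (iter j sq c).
    have h6 : (1 - t) ^+ K * unorm (iter j sq a) <= B ^+ (2 ^ j) by rewrite sqn.
    nra.
  - by rewrite exprn_gt0.
apply: filterS main => u; rewrite sqn => le.
rewrite -(ler_pXn2r (n := 2 ^ j)) ?expn_gt0 ?nnegrE ?unorm_ge0 //; last lra.
apply: le_trans le (le_trans _ hj); lra.
Qed.

End Damping.

(** * NC *-polynomials *)

Section Words.
Variables (R : realType) (A : cstarAlgType R).
Local Notation U := (unitization A).
Implicit Types (v : nat -> A) (w : seq letter) (l : letter).

Lemma eval_word_rcons (B : preStarAlgType R[i]) (v : nat -> B) w l : w != [::] ->
  eval_word v (rcons w l) = eval_word v w ** eval_letter v l.
Proof. by case: w => // l0 w _; rewrite /= foldl_rcons. Qed.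

Lemma rnorm_eval_letter v l : rnorm (eval_letter v l) = rnorm (v l.1).
Proof. by rewrite /eval_letter; case: l.2; rewrite ?rnorm_star. Qed.

Lemma rnorm_eval_letterB v v' l :
  rnorm (eval_letter v l - eval_letter v' l) = rnorm (v l.1 - v' l.1).
Proof. by rewrite /eval_letter; case: l.2; rewrite // -starB rnorm_star. Qed.

(** Each variable has its own bound, since the [z n] need not be uniformly bounded. Bounding the
    value along with the increment is what makes the property pass to products. *)
Definition lipschitz_on (b : nat -> R) (f : (nat -> A) -> A) (K : R) : Prop :=
  forall v v' e, (forall i, rnorm (v i) <= b i) ->
    (forall i, rnorm (v' i) <= b i) -> (forall i, rnorm (v i - v' i) <= e) ->
  rnorm (f v) <= K /\ rnorm (f v - f v') <= K * e.

Lemma eval_word_lipschitz (b : nat -> R) w :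
  exists2 K, 0 <= K & lipschitz_on b (fun v => eval_word v w) K.
Proof.
elim/last_ind: w => [|w l [K K0 HK]].
  by exists 0 => // v v' e _ _ _; rewrite subrr rnorm0 mul0r.
pose c := 1 + `|b l.1|.
have c0 : 0 <= `|b l.1| by [].
have bc : b l.1 <= `|b l.1| by apply: ler_norm.
case: (eqVneq w [::]) => [->|w0].
  exists c => [|v v' e vb vb' vv']; first by rewrite /c; lra.
  rewrite /= rnorm_eval_letter rnorm_eval_letterB.
  have := vb l.1; have := vv' l.1; have := rnorm_ge0 (v l.1 - v' l.1).
  rewrite /c; nra.
exists (K * c) => [|v v' e vb vb' vv']; first by rewrite mulr_ge0 // /c; lra.
have [h1 h2] := HK _ _ _ vb vb' vv'.
(* Comparing [v'] with itself extracts the bound on its own value. *)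
have vv0 i : rnorm (v' i - v' i) <= 0 by rewrite subrr rnorm0.
have [h3 _] := HK _ _ _ vb' vb' vv0.
rewrite !eval_word_rcons //.
have x1 := rnormM (eval_word v w) (eval_letter v l).
have -> : eval_word v w ** eval_letter v l - eval_word v' w ** eval_letter v' l =
    (eval_word v w - eval_word v' w) ** eval_letter v l +
    eval_word v' w ** (eval_letter v l - eval_letter v' l).
  by rewrite numulBl numulBr addrA subrK.
have x2 := rnormM (eval_word v w - eval_word v' w) (eval_letter v l).
have x3 := rnormM (eval_word v' w) (eval_letter v l - eval_letter v' l).
have x4 := rnormD ((eval_word v w - eval_word v' w) ** eval_letter v l)
    (eval_word v' w ** (eval_letter v l - eval_letter v' l)).
rewrite rnorm_eval_letter in x1 x2; rewrite rnorm_eval_letterB in x3.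
have lb := le_trans (vb l.1) bc.
have y1 := ler_pM (rnorm_ge0 _) (rnorm_ge0 _) h1 lb.
have y2 := ler_pM (rnorm_ge0 _) (rnorm_ge0 _) h2 lb.
have y3 := ler_pM (rnorm_ge0 _) (rnorm_ge0 _) h3 (vv' l.1).
rewrite /c !mulrDr mulr1; split; lra.
Qed.

Lemma eval_ncpoly_lipschitz (b : nat -> R) (p : ncpoly R) :
  exists2 K, 0 <= K & lipschitz_on b (fun v => eval_ncpoly v p) K.
Proof.
rewrite /eval_ncpoly; elim: (finmap.enum_fset (monalg.msupp p)) => [|m s [K K0 HK]].
  by exists 0 => // v v' e _ _ _; rewrite !big_nil subrr rnorm0 mul0r.
have [C C0 HC] := eval_word_lipschitz b (monalg.fmonom_val m).
set c : R[i] := monalg.mcoeff m p.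
have c0 : 0 <= complex.Re `|c| := rnorm_ge0 (c : R[i]^o).
exists (complex.Re `|c| * C + K) => [|v v' e vb vb' vv'].
  by rewrite addr_ge0 ?mulr_ge0.
have [h1 h2] := HK _ _ _ vb vb' vv'; have [h3 h4] := HC _ _ _ vb vb' vv'.
rewrite !big_cons; split; first by rewrite (le_trans (rnormD _ _)) // rnormZ lerD // ler_wpM2l.
rewrite opprD addrACA -scalerBr (le_trans (rnormD _ _)) // rnormZ mulrDl.
by rewrite lerD // -mulrA ler_wpM2l.
Qed.

Definition scale_vars (S : pred nat) (m : U) v (i : nat) : A :=
  if S i then lact m (v i) else v i.

Section Asymptotics.
Variables (I : cstarIdeal A) (t : R).
Hypothesis t01 : 0 <= t <= 1.
Local Notation "f ~~ g" := (asymp_eq (quasicentral I) f g) (at level 70).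

Lemma asymp_eval_letter (S : pred nat) v l :
  (fun u => inu (eval_letter (scale_vars S (damp t u) v) l)) ~~
  (fun u => damp t u ^+ S l.1 * inu (eval_letter v l)).
Proof.
rewrite /eval_letter /scale_vars.
case: (S l.1); last first.
  by apply: asymp_near_eq; apply: nearW => u; rewrite mul1r.
case: l.2; last first.
  by apply: asymp_near_eq; apply: nearW => u; rewrite inu_lact.
apply: (@asymp_trans _ _ _ _ _ (fun u => ustar (damp t u ^+ 1 * inu (v l.1)))).
  by apply: asymp_near_eq; apply: nearW => u; rewrite -inu_lact -ustar_inu.
rewrite -ustar_inu; exact: asymp_damp_star.
Qed.

(** Each letter from [S], starred or not, contributes one [damp t u]; as these asymptotically
    commute with everything, they collect on the left. *)
Lemma asymp_eval_word (S : pred nat) v w :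
  (fun u => inu (eval_word (scale_vars S (damp t u) v) w)) ~~
  (fun u => damp t u ^+ count (fun l : letter => S l.1) w * inu (eval_word v w)).
Proof.
elim/last_ind: w => [|w l IH].
  (* The empty word has the value 0, so both sides vanish. For the same reason one-letter words are
     treated apart: appending a letter is a product only for nonempty words. *)
  by apply: asymp_near_eq; apply: nearW => u; rewrite /= inu0 mulr0.
case: (eqVneq w [::]) => [->|w0].
  by rewrite /= addn0; apply: asymp_eval_letter.
apply: (@asymp_trans _ _ _ _ _ (fun u =>
  inu (eval_word (scale_vars S (damp t u) v) w) *
  inu (eval_letter (scale_vars S (damp t u) v) l))).
  by apply: asymp_near_eq; apply: nearW => u; rewrite eval_word_rcons // inuM.
apply: (@asymp_trans _ _ _ _ _ (fun u =>
  (damp t u ^+ count (fun l : letter => S l.1) w * inu (eval_word v w)) *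
  (damp t u ^+ S l.1 * inu (eval_letter v l)))).
  apply: asymp_mul => //; [exact: bounded_dampX_mul|exact: bounded_dampX_mul|].
  exact: asymp_eval_letter.
apply: asymp_trans (asymp_damp_mul _ _ _ _ _ _) _ => //.
apply: asymp_near_eq; apply: nearW => u.
by rewrite eval_word_rcons // inuM -cats1 count_cat /= addn0.
Qed.

Lemma asymp_eval_ncpoly (S : pred nat) v d (p : ncpoly R) : homogeneous S d p ->
  (fun u => inu (eval_ncpoly (scale_vars S (damp t u) v) p)) ~~
  (fun u => damp t u ^+ d * inu (eval_ncpoly v p)).
Proof.
move=> hp; rewrite /eval_ncpoly.
apply: (@asymp_trans _ _ _ _ _ (fun u => \sum_(m <- finmap.enum_fset (monalg.msupp p))
  monalg.mcoeff m p *: inu (eval_word (scale_vars S (damp t u) v) (monalg.fmonom_val m)))).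
  apply: asymp_near_eq; apply: nearW => u; rewrite raddf_sum /=.
  by apply: eq_bigr => m _; rewrite inuZ.
apply: (@asymp_trans _ _ _ _ _ (fun u => \sum_(m <- finmap.enum_fset (monalg.msupp p))
  monalg.mcoeff m p *: (damp t u ^+ d * inu (eval_word v (monalg.fmonom_val m))))).
  apply: asymp_sum => m mp; apply: asymp_scale; rewrite -(hp m mp).
  exact: asymp_eval_word.
apply: asymp_near_eq; apply: nearW => u; rewrite raddf_sum mulr_sumr /=.
by apply: eq_bigr => m _; rewrite inuZ scalerAr.
Qed.
End Asymptotics.

Section Quotient.
Variable I : cstarIdeal A.
Local Notation Q := (cquot I).

Lemma cquot_pi_star (a : A) : \pi_Q (star a) = star (\pi_Q a).
Proof.
rewrite [RHS]/star /= -lock.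
apply/cquotP; rewrite -starB; apply: ideal_star.
by apply/cquotP; rewrite reprK.
Qed.

Lemma cquot_pi_eval_letter v l :
  \pi_Q (eval_letter v l) = eval_letter (fun i => \pi_Q (v i)) l.
Proof. by rewrite /eval_letter; case: l.2; rewrite ?cquot_pi_star. Qed.

Lemma cquot_pi_eval_word v w :
  \pi_Q (eval_word v w) = eval_word (fun i => \pi_Q (v i)) w.
Proof.
case: w => [|l w]; first exact: cquot_pi0.
elim/last_ind: w => [|w k IH]; first exact: cquot_pi_eval_letter.
by rewrite -rcons_cons !eval_word_rcons // cquot_piM IH cquot_pi_eval_letter.
Qed.

Lemma cquot_pi_eval_ncpoly v (p : ncpoly R) :
  \pi_Q (eval_ncpoly v p) = eval_ncpoly (fun i => \pi_Q (v i)) p.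
Proof.
rewrite /eval_ncpoly; elim: (finmap.enum_fset (monalg.msupp p)) => [|m s IH].
  by rewrite !big_nil cquot_pi0.
by rewrite !big_cons cquot_piD IH cquot_piZ cquot_pi_eval_word.
Qed.
End Quotient.
End Words.

(** * Lifting *)

Section ApproximateCorrection.
Variables (R : realType) (A : cstarAlgType R).
Local Notation U := (unitization A).

Lemma compressE (a y : U) :
  y - a * y * ustar a = (1 - a) * y + a * y * ustar (1 - a).
Proof. by rewrite ustarB ustar1 mulrBl mul1r mulrBr mulr1 addrA subrK. Qed.

(* [m] cuts [x] off where [x x^*] is small, and [e] is the compression of [y] *)
(* to where [x^* x] is not small. The second threshold is so much smaller     *)
(* than the first one that [x - m x] kills what is left of [y], and [e] is    *)
(* the image of [x y x^*] under a bounded two-sided multiplication.           *)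
Lemma approximate_correction (B : R) (x y : A) (s : nat) :
  1 <= B -> (0 < s)%N -> rnorm x <= B -> rnorm y <= B ->
  rnorm (x ** y ** star x) <= s%:R^-1 ^+ 20 ->
  exists (m : U) (e : A),
    [/\ rnorm (lact m x) <= 32 * (2 * B ^+ 2 + 1) / s%:R,
        rnorm e <= 64 / s%:R,
        forall I : cstarIdeal A, x ** y ** star x \in I -> e \in I &
        rnorm ((x - lact m x) ** (y - e) ** star (x - lact m x))
          <= 768 * B ^+ 3 * s%:R^-1 ^+ 24].
Proof.
move=> B1 s0 xB yB xyx.
pose c : R := 2 * B ^+ 2 + 1.
have B2 : 1 <= B ^+ 2 by rewrite exprn_ege1.
have c1 : 1 <= c by rewrite /c; lra.
have c0 : 0 < c by lra.
have cV : 0 <= c^-1 by rewrite invr_ge0 ltW.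
have sR : 0 < s%:R :> R by rewrite ltr0n.
have x2 : rnorm x ^+ 2 <= B ^+ 2 by rewrite lerXn2r ?nnegrE ?rnorm_ge0 //; lra.
pose h := c^-1%:C *: (star x ** x); pose h' := c^-1%:C *: (x ** star x).
have hs : star h = h by rewrite starZr starM starK.
have h's : star h' = h' by rewrite starZr starM starK.
have hn : rnorm h <= 2^-1.
  rewrite rnormZr rnorm_cstar ger0_norm // ler_pdivrMl // /c; lra.
have h'n : rnorm h' <= 2^-1.
  rewrite rnormZr rnorm_cstarr ger0_norm // ler_pdivrMl // /c; lra.
have s2 : (0 < s ^ 2)%N by rewrite expn_gt0 s0.
have s8 : (0 < s ^ 8)%N by rewrite expn_gt0 s0.
have [v' [q' [v'1 h'v' q'n vq' [comm_h'v' comm_h'q']]]] := spectral_cutoff h's h'n s2.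
have [v [q [v1 hv qn vq [comm_hv comm_hq]]]] := spectral_cutoff hs hn s8.
(* With k-th powers the remainder is of order (s^2)^k (s^-8)^k = s^-6k; k = 4 is the first for which
   this beats s^-20. *)
pose M := (1 - v') ^+ 4; pose E := 1 - v ^+ 4.
pose G := \sum_(i < 4) (1 - v') ^+ i.
pose K := (\sum_(i < 4) v ^+ i) * q.
have ME : 1 - M = G * v' by rewrite -geometric_sum_mul subKr.
have EE : E = K * inu h by rewrite /E -geometric_sum_mul vq mulrA.
have v'2 : unorm (1 - v') <= 2.
  have := unormD 1 (- v'); rewrite unormN; have := unorm1_le A; lra.
have Mn : unorm M <= 16.
  apply: le_trans (unormX _ _) _; have -> : 16 = 2 ^+ 4 :> R by ring.
  by rewrite lerXn2r ?nnegrE ?unorm_ge0.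
have Gn : unorm G <= 32.
  have -> : 32 = 4%:R * 8 :> R by ring.
  apply: unorm_sum_le => i i4; apply: le_trans (unormX _ _) _.
  apply: (@le_trans _ _ (2 ^+ i)); first by rewrite lerXn2r ?nnegrE ?unorm_ge0.
  have -> : 8 = 2 ^+ 3 :> R by ring.
  by rewrite ler_weXn2l // ?ler1n.
have Kn : unorm K <= 8 * s%:R ^+ 8.
  have h1 : unorm (\sum_(i < 4) v ^+ i) <= 4%:R * 1.
    by apply: unorm_sum_le => i _; apply: unormX_le1.
  apply: le_trans (unormM _ _) _.
  have := ler_pM (unorm_ge0 _) (unorm_ge0 _) h1 qn; rewrite natrX; lra.
have En : unorm E <= 2.
  have := unormD 1 (- v ^+ 4); rewrite unormN; have := unorm1_le A.
  have := unormX_le1 4 v1; rewrite -/E; lra.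
have vx : unorm (v' * inu x) <= c / s%:R.
  have cs : 0 <= c / s%:R by rewrite divr_ge0 // ltW.
  rewrite -(ler_pXn2r (n := 2)) ?nnegrE ?unorm_ge0 //.
  have hx : x ** star x = c%:C *: h' by rewrite real_scaleK // gt_eqF.
  apply: le_trans (unorm_cutoff (ltW c0) hx v'1 comm_h'v' h'v') _.
  rewrite natrX expr_div_n ler_pM2r ?invr_gt0 ?exprn_gt0 //.
  by rewrite expr2 ler_peMr // ltW.
have Dn : rnorm (lact (1 - M) x) <= 32 * c / s%:R.
  rewrite -unorm_inu inu_lact ME -(mulrA G); apply: le_trans (unormM _ _) _.
  by rewrite -[leRHS]mulrA ler_pM ?unorm_ge0.
pose e := ract (lact K (h ** y ** h)) (ustar K).
have eE : inu e = E * inu y * ustar E.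
  rewrite inu_ract inu_lact EE ustarM ustar_inu hs !inuM.
  by rewrite !mulrA.
(* This reveals the triple inside [e]: it puts [e] in every ideal containing the triple, and bounds
   [e] by (8 s^8)^2 s^-20 = 64 s^-4. *)
have hyh : h ** y ** h = (c^-1%:C * c^-1%:C) *: (star x ** (x ** y ** star x) ** x).
  by rewrite /h !(numulZl, numulZr) scalerA !numulA.
have hyhn : rnorm (h ** y ** h) <= s%:R^-1 ^+ 20.
  rewrite hyh -rmorphM rnormZr ger0_norm ?mulr_ge0 //.
  have h1 := rnormM (star x) (x ** y ** star x).
  have h2 := rnormM (star x ** (x ** y ** star x)) x.
  rewrite rnorm_star in h1.
  have h3 := le_trans h2 (ler_wpM2r (rnorm_ge0 x) h1).
  apply: le_trans (ler_wpM2l (mulr_ge0 cV cV) h3) _.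
  have cx : c^-1 * c^-1 * rnorm x ^+ 2 <= 1.
    by rewrite -invfM ler_pdivrMl ?mulr_gt0 // mulr1; move: x2 c1; rewrite /c; nra.
  have -> : c^-1 * c^-1 * (rnorm x * rnorm (x ** y ** star x) * rnorm x) =
      c^-1 * c^-1 * rnorm x ^+ 2 * rnorm (x ** y ** star x) by ring.
  by apply: le_trans (ler_wpM2r (rnorm_ge0 _) cx) _; rewrite mul1r.
exists (1 - M), e; split=> //.
- rewrite -unorm_inu inu_ract inu_lact; apply: le_trans (unormM _ _) _.
  rewrite unorm_star; apply: le_trans (ler_wpM2r (unorm_ge0 _) (unormM _ _)) _.
  rewrite unorm_inu.
  have h1 := ler_pM (unorm_ge0 _) (rnorm_ge0 _) Kn hyhn.
  have h2 := ler_pM (mulr_ge0 (unorm_ge0 _) (rnorm_ge0 _)) (unorm_ge0 _) h1 Kn.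
  apply: le_trans h2 _.
  have -> : 8 * s%:R ^+ 8 * s%:R^-1 ^+ 20 * (8 * s%:R ^+ 8) = 64 * s%:R^-1 ^+ 4 :> R.
    field; exact: lt0r_neq0.
  have sV1 : s%:R^-1 <= 1 :> R by rewrite invf_le1 // ler1n.
  have sV0 : 0 <= s%:R^-1 :> R by rewrite invr_ge0 ltW.
  by rewrite ler_wpM2l // -[leRHS]expr1 ler_wiXn2l.
- move=> I xyxI; apply/uideal_inu; rewrite inu_ract inu_lact.
  apply/uidealMr/uidealMl/uideal_inu; rewrite hyh rpredZ //.
  by apply/ideal_mulr/ideal_mull.
- pose X := inu x; pose Y := inu y; pose P := M * X * v ^+ 4.
  have X'E : inu (x - lact (1 - M) x) = M * X.
    by rewrite inuB inu_lact mulrBl mul1r subKr.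
  have hX k : inu h' ^+ k * X = X * inu h ^+ k.
    elim: k => [|k IH]; first by rewrite mul1r mulr1.
    rewrite exprSr -mulrA; have -> : inu h' * X = X * inu h.
      by rewrite !inuZ -scalerAl -scalerAr !inuM mulrA.
    by rewrite mulrA IH -mulrA -exprSr.
  have PE : P = q' ^+ 4 * (X * (inu h * v) ^+ 4).
    rewrite /P /M vq' exprMn_comm; last exact/commr_sym.
    by rewrite exprMn_comm // -(mulrA (q' ^+ 4)) hX !mulrA.
  have Pn : unorm P <= 16 * B * s%:R^-1 ^+ 24.
    rewrite PE; apply: le_trans (unormM _ _) _.
    have h1 : unorm (q' ^+ 4) <= (2 * s%:R ^+ 2) ^+ 4.
      apply: le_trans (unormX _ _) _.
      by rewrite lerXn2r ?nnegrE ?unorm_ge0 -?natrX // mulr_ge0.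
    have h2 : unorm ((inu h * v) ^+ 4) <= (s%:R^-1 ^+ 8) ^+ 4.
      apply: le_trans (unormX _ _) _.
      by rewrite lerXn2r ?nnegrE ?unorm_ge0 ?exprn_ge0 ?invr_ge0 // exprVn -natrX.
    have h3 : unorm X <= B by rewrite unorm_inu.
    have h4 := unormM X ((inu h * v) ^+ 4).
    have h5 := ler_pM (unorm_ge0 _) (unorm_ge0 _) h3 h2.
    apply: le_trans (ler_pM (unorm_ge0 _) (unorm_ge0 _) h1 (le_trans h4 h5)) _.
    rewrite le_eqVlt; apply/orP; left; apply/eqP; field; exact: lt0r_neq0.
  rewrite -unorm_inu.
  (* By [compressE] each of the two terms has [v ^+ 4] or its adjoint next to a copy of the new x,
     hence contains [P] or its adjoint. The constant is 768 = 16 * 16 + 16 * 2 * 16. *)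
  have -> : inu ((x - lact (1 - M) x) ** (y - e) ** star (x - lact (1 - M) x)) =
      P * Y * ustar (M * X) + (M * X) * E * Y * ustar P.
    rewrite !inuM -ustar_inu X'E inuB eE -/Y.
    have -> : Y - E * Y * ustar E = v ^+ 4 * Y + E * Y * ustar (v ^+ 4).
      by rewrite compressE subKr.
    by rewrite mulrDr mulrDl /P !ustarM !mulrA.
  have X'n : unorm (M * X) <= 16 * B.
    apply: le_trans (unormM _ _) _; rewrite ler_pM ?unorm_ge0 //.
    by rewrite unorm_inu.
  have Yn : unorm Y <= B by rewrite unorm_inu.
  apply: le_trans (unormD _ _) _.
  have h1 : unorm (P * Y * ustar (M * X)) <= 16 * B * s%:R^-1 ^+ 24 * B * (16 * B).
    apply: le_trans (unormM _ _) _; rewrite unorm_star ler_pM ?unorm_ge0 //.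
    by apply: le_trans (unormM _ _) _; rewrite ler_pM ?unorm_ge0.
  have h2 : unorm (M * X * E * Y * ustar P) <= 16 * B * 2 * B * (16 * B * s%:R^-1 ^+ 24).
    apply: le_trans (unormM _ _) _; rewrite unorm_star ler_pM ?unorm_ge0 //.
    apply: le_trans (unormM _ _) _; rewrite ler_pM ?unorm_ge0 //.
    by apply: le_trans (unormM _ _) _; rewrite ler_pM ?unorm_ge0.
  have -> : 768 * B ^+ 3 * s%:R^-1 ^+ 24 = 16 * B * s%:R^-1 ^+ 24 * B * (16 * B) +
     16 * B * 2 * B * (16 * B * s%:R^-1 ^+ 24) by ring.
  exact: lerD.
Qed.
End ApproximateCorrection.

Lemma xyzP (r i : nat) :
  [\/ exists2 k : 'I_r, (i < 2 * r)%N & forall T (x y : 'I_r -> T) z, xyz x y z i = x k,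
      exists2 k : 'I_r, (i < 2 * r)%N & forall T (x y : 'I_r -> T) z, xyz x y z i = y k |
      ~~ (i < 2 * r)%N /\
      forall T (x y : 'I_r -> T) z, xyz x y z i = z (i - 2 * r)%N].
Proof.
case: (ltnP i r) => ir.
  constructor 1; exists (Ordinal ir) => [|T x y z]; first by rewrite mul2n -addnn ltn_addr.
  by rewrite /xyz insubT.
case: (ltnP i (2 * r)) => i2r.
  have ir2 : (i - r < r)%N by rewrite ltn_subLR // addnn -mul2n.
  constructor 2; exists (Ordinal ir2) => // T x y z.
  by rewrite /xyz insubF ?insubT // ltnNge ir.
constructor 3; split=> // T x y z.
rewrite /xyz insubF ?insubF // ltnNge ?ir //.
by rewrite leq_subRL // addnn -mul2n i2r.
Qed.

Lemma xyz_fst (T : Type) (r : nat) (x y : 'I_r -> T) z (k : 'I_r) : xyz x y z k = x k.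
Proof. by rewrite /xyz valK. Qed.

Lemma xyz_snd (T : Type) (r : nat) (x y : 'I_r -> T) z (k : 'I_r) :
  xyz x y z (r + k)%N = y k.
Proof. by rewrite /xyz insubF ?ltnNge ?leq_addr // addKn valK. Qed.

(** With w = 1/s, an error of order above n beats half of the target (2 s)^-n as soon as s absorbs
    the constants. *)
Lemma scaled_power_le (R : realFieldType) (b w : R) (n m : nat) : 0 <= w <= 1 -> 0 <= b ->
  b * 2 ^+ n.+1 * w <= 1 -> b * w ^+ (n + m.+1) <= (w / 2) ^+ n / 2.
Proof.
move=> /andP[w0 w1] b0 bw.
have -> : (w / 2) ^+ n / 2 = w ^+ n / 2 ^+ n.+1.
  by rewrite expr_div_n -mulrA -invfM -exprSr.
have q0 : 0 < 2 ^+ n.+1 :> R by rewrite exprn_gt0.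
rewrite ler_pdivlMr // exprD exprS; move: (2 ^+ n.+1) q0 bw => q q0 bw.
have -> : b * (w ^+ n * (w * w ^+ m)) * q = w ^+ n * (b * q * w * w ^+ m) by ring.
rewrite ler_piMr ?exprn_ge0 // mulr_ile1 ?exprn_ge0 ?exprn_ile1 //.
by rewrite !mulr_ge0 // ltW.
Qed.

(** * Successive approximation of the lifts *)

Section Lifting.
Variables (R : realType) (r J : nat) (p : 'I_J -> ncpoly R) (d : 'I_J -> nat).
Hypothesis d0 : forall j, (1 <= d j)%N.
Hypothesis p_homogeneous : forall j, homogeneous (fun i => (i < 2 * r)%N) (d j) (p j).
Variables (C : 'I_J -> R) (A : cstarAlgType R) (I : cstarIdeal A).
Hypothesis C0 : forall j, 0 < C j.
Variables (x0 y0 : 'I_r -> A) (z : nat -> A).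
Local Notation Q := (cquot I).
Local Notation U := (unitization A).
Hypothesis xy0 : forall k : 'I_r,
  \pi_Q (x0 k) ** \pi_Q (y0 k) ** star (\pi_Q (x0 k)) = 0 :> Q.
Hypothesis pC : forall j : 'I_J,
  `| eval_ncpoly (xyz (fun k => \pi_Q (x0 k)) (fun k => \pi_Q (y0 k))
                      (fun n => \pi_Q (z n)) : nat -> Q) (p j) | <= (C j)%:C.
Implicit Types x y : 'I_r -> A.

Definition lifts x y : Prop :=
  forall k, \pi_Q (x k) = \pi_Q (x0 k) /\ \pi_Q (y k) = \pi_Q (y0 k).

Definition pval j x y : R := rnorm (eval_ncpoly (xyz x y z) (p j)).
Definition tval k x y : R := rnorm (x k ** y k ** star (x k)).

(** The relation written as a word, so that the damping and Lipschitz results for words apply to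
    it. *)
Definition tword (k : 'I_r) : seq letter :=
  [:: (nat_of_ord k, false); ((r + k)%N, false); (nat_of_ord k, true)].

Lemma eval_tword (k : 'I_r) x y :
  eval_word (xyz x y z) (tword k) = x k ** y k ** star (x k).
Proof. by rewrite /= /eval_letter /= !xyz_fst xyz_snd. Qed.

Lemma lifts_ideal x y x' y' : lifts x y -> (forall k, x k - x' k \in I) ->
  (forall k, y k - y' k \in I) -> lifts x' y'.
Proof.
move=> xy xI yI k; have [<- <-] := xy k.
by split; apply/esym/cquotP.
Qed.

Lemma lifts_triple x y k : lifts x y -> x k ** y k ** star (x k) \in I.
Proof.
move=> /(_ k)[xk yk].
have : \pi_Q (x k ** y k ** star (x k)) = \pi_Q 0.
  by rewrite cquot_pi0 !cquot_piM cquot_pi_star xk yk; apply: xy0.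
by move/cquotP; rewrite subr0.
Qed.

Lemma lifts_quotient_norm x y j (e : R) : lifts x y -> 0 < e ->
  exists2 a, eval_ncpoly (xyz x y z) (p j) - a \in I & rnorm a <= C j + e.
Proof.
move=> xy e0.
have vE : (fun i => \pi_Q (xyz x y z i)) =
    xyz (fun k => \pi_Q (x0 k)) (fun k => \pi_Q (y0 k)) (fun n => \pi_Q (z n)).
  apply/funext => i; case: (xyzP r i) => [[k _ E]|[k _ E]|[_ E]]; rewrite !E //.
    by case: (xy k).
  by case: (xy k).
have := pC j; rewrite -vE -cquot_pi_eval_ncpoly.
set a := eval_ncpoly _ _ => aC.
have [b pb bn] := cquot_norm_adh (\pi_Q a) e0.
exists b; first by apply/cquotP.
have : inf (cquot_norms (\pi_Q a)) <= C j by rewrite -lecR.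
by move=> h; apply/ltW/(lt_le_trans bn); rewrite lerD2r.
Qed.

(** Finitely many conditions hold near the filter, so one [u] serves all of them. The factor 2 in
    the displacement bounds |u|. *)
Lemma damping_step x y (t D e : R) : 0 <= t <= 1 -> 0 < e -> 0 <= D ->
  lifts x y ->
  (forall j, (1 - t) * pval j x y <= C j) -> (forall k, (1 - t) * tval k x y <= D) ->
  exists x' y', [/\ lifts x' y',
    forall k, rnorm (x' k) <= rnorm (x k) /\ rnorm (y' k) <= rnorm (y k),
    forall k, rnorm (x' k - x k) <= 2 * t * rnorm (x k) /\
              rnorm (y' k - y k) <= 2 * t * rnorm (y k),
    forall j, pval j x' y' <= C j + e & forall k, tval k x' y' <= D + e].
Proof.
move=> t01 e0 D0 xy pxy txy; have /andP[t0 t1] := t01.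
have e4 : 0 < e / 4 by rewrite divr_gt0.
have e2 : 0 < e / 2 by rewrite divr_gt0.
pose X u k := lact (damp t u) (x k); pose Y u k := lact (damp t u) (y k).
pose S i := (i < 2 * r)%N.
have scaleE u : xyz (X u) (Y u) z = scale_vars S (damp t u) (xyz x y z).
  apply/funext => i; rewrite /scale_vars /S.
  by case: (xyzP r i) => [[k -> E]|[k -> E]|[/negbTE -> E]]; rewrite !E.
have FF : Filter (quasicentral I) by exact _.
have near_p : quasicentral I [set u | forall j, pval j (X u) (Y u) <= C j + e]%classic.
  apply: (@filter_forall _ _ (fun j u => pval j (X u) (Y u) <= C j + e) _ FF) => j.
  have [a aI an] := lifts_quotient_norm j xy e4.
  have := @near_damp_mul_le _ _ I t t01 (inu (eval_ncpoly (xyz x y z) (p j))) (inu a)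
    (d j) (C j + e / 4) (e / 4) (d0 j).
  rewrite -inuB !unorm_inu => /(_ _ e4 _ an) h.
  have {}h := h (ltac:(by rewrite addr_gt0 // C0)) (proj2 (uideal_inu I _) aI)
     (ltac:(by rewrite (le_trans (pxy j)) // lerDl ltW)).
  have h' := asymp_unorm_le (FF := FF)
    (asymp_eval_ncpoly I t01 (xyz x y z) (p_homogeneous (j := j))) h e2.
  apply: filterS h' => u /=; rewrite unorm_inu /pval scaleE => /le_trans; apply; lra.
have near_t : quasicentral I [set u | forall k, tval k (X u) (Y u) <= D + e]%classic.
  apply: (@filter_forall _ _ (fun k u => tval k (X u) (Y u) <= D + e) _ FF) => k.
  have gI := lifts_triple k xy.
  (* The triple lies in [I], so it is compared with 0. As [D] may be 0, [e / 4] is added to make the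
     bound positive. *)
  have := @near_damp_mul_le _ _ I t t01 (inu (eval_word (xyz x y z) (tword k))) 0
    (count (fun l : letter => S l.1) (tword k)) (D + e / 4) (e / 4) _ _ e4.
  rewrite subr0 unorm0 unorm_inu eval_tword => h.
  have {}h := h (ltac:(by rewrite /S /= addn_gt0 lt0b mul2n -addnn ltn_addr))
     (ltac:(lra)) (proj2 (uideal_inu I _) gI) (ltac:(lra))
     (ltac:(by rewrite (le_trans (txy k)) // lerDl ltW)).
  rewrite -eval_tword in h.
  have h' := asymp_unorm_le (FF := FF) (asymp_eval_word I t01 S (xyz x y z) (tword k)) h e2.
  apply: filterS h' => u; rewrite unorm_inu /tval -scaleE eval_tword => /le_trans; apply; lra.
have near_pt := @filterI _ (quasicentral I) FF _ _ near_p near_t.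
have near_all := @filterI _ (quasicentral I) FF _ _ (near_quasicentral_ideal I)
  (@filterI _ (quasicentral I) FF _ _ (near_unorm_damp I t01) near_pt).
have [u [[uI us u1] [u2 [up ut]]]] := @filter_ex _ _ (quasicentral_filter I) _ near_all.
have un : unorm u <= 2.
  have := unorm_tri 1 u 0; rewrite !subr0 unormB; have := unorm1_le A; lra.
have dE (a : A) : a - lact (damp t u) a = lact (t%:C *: u) a.
  by apply: inu_inj; rewrite inuB !inu_lact mulrBl mul1r subKr.
have dn (a : A) : rnorm (lact (damp t u) a) <= rnorm a.
  by apply: le_trans (unormP _ _) _; rewrite ler_piMl ?rnorm_ge0.
have dB (a : A) : rnorm (lact (damp t u) a - a) <= 2 * t * rnorm a.
  rewrite rnormB dE; apply: le_trans (unormP _ _) _; rewrite ler_wpM2r ?rnorm_ge0 //.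
  by apply: le_trans (unormZr _ t0) _; rewrite mulrC ler_wpM2r.
have dI (a : A) : a - lact (damp t u) a \in I.
  by rewrite dE; apply/uideal_inu; rewrite inu_lact; apply/uidealMr/uidealZ.
exists (X u), (Y u); split=> // [|k|k]; first exact: (lifts_ideal xy).
  by split; apply: dn.
by split; apply: dB.
Qed.

(** The cutoff of [x] is applied only under [u], so the coset is kept. The relation does not notice
    the difference, because every term of the expanded product contains an element of [I], on which
    [u] acts as 1. *)
Lemma correction_step (B e : R) (s : nat) x y :
  1 <= B -> (0 < s)%N -> 0 < e -> lifts x y ->
  (forall k, rnorm (x k) <= B) -> (forall k, rnorm (y k) <= B) ->
  (forall k, tval k x y <= s%:R^-1 ^+ 20) ->
  exists x' y', [/\ lifts x' y',
    forall k, rnorm (x' k - x k) <= 64 * (2 * B ^+ 2 + 1) / s%:R,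
    forall k, rnorm (y' k - y k) <= 64 / s%:R &
    forall k, tval k x' y' <= 768 * B ^+ 3 * s%:R^-1 ^+ 24 + e].
Proof.
move=> B1 s0 e0 xy xB yB txy.
have [m hm] := choice (fun k => approximate_correction B1 s0 (xB k) (yB k) (txy k)).
have [f hf] := choice hm => {hm}.
pose D k := lact (m k) (x k).
pose X u k := x k - lact u (D k); pose Y k := y k - f k.
have FF : Filter (quasicentral I) by exact _.
have fI k : f k \in I by have [_ _ h _] := hf k; apply/h/lifts_triple.
have near_t : quasicentral I
    [set u | forall k, tval k (X u) Y <= 768 * B ^+ 3 * s%:R^-1 ^+ 24 + e]%classic.
  apply: (@filter_forall _ _
    (fun k u => tval k (X u) Y <= 768 * B ^+ 3 * s%:R^-1 ^+ 24 + e) _ FF) => k.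
  have [_ _ _ tk] := hf k.
  pose x1 := inu (x k); pose y1 := inu (Y k); pose d1 := inu (D k).
  have gI : uideal I (x1 * y1 * ustar x1).
    rewrite ustar_inu -!inuM; apply/uideal_inu.
    rewrite /Y numulBr numulBl rpredB //; first exact: lifts_triple.
    by apply/ideal_mulr/ideal_mull.
  have d1E : d1 = m k * x1 by apply: inu_lact.
  have asym : asymp_eq (quasicentral I)
     (fun u => inu (X u k ** Y k ** star (X u k)))
     (fun=> inu ((x k - D k) ** Y k ** star (x k - D k))).
    have g1I := uidealMl (m k) gI.
    have g2I := uidealMr (ustar (m k)) gI.
    have g3I := uidealMr (ustar (m k)) g1I.
    pose g := x1 * y1 * ustar x1.
    have expand (a b : U) : (a - b) * y1 * ustar (a - b) =
        a * y1 * ustar a - b * y1 * ustar a - (a * y1 * ustar b - b * y1 * ustar b).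
      rewrite !mulrBl ustarB !mulrBr !opprB addrACA [RHS]addrACA.
      by congr (_ + _); rewrite addrC.
    have E u : inu (X u k ** Y k ** star (X u k)) =
        g - u * (m k * g) - (g * ustar (m k) * ustar u - u * (m k * g * ustar (m k)) * ustar u).
      rewrite !inuM -ustar_inu /X inuB inu_lact -/x1 -/y1 -/d1 expand.
      by rewrite d1E !ustarM !mulrA.
    apply: (@asymp_trans _ _ _ _ _ (fun u =>
      g - u * (m k * g) - (g * ustar (m k) * u - u * (m k * g * ustar (m k)) * u))).
      apply: asymp_near_eq; apply: (@filterS _ _ FF _ _ _ (near_quasicentral_ideal I)).
      by move=> u [_ us _]; rewrite E us.
    apply: (@asymp_trans _ _ _ _ _ (fun u =>
      g - (m k * g) - (g * ustar (m k) - (m k * g * ustar (m k))))).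
      apply: asymp_sub; first by apply: asymp_sub; [apply: asymp_refl|apply: asymp_ideal_l].
      by apply: asymp_sub; [apply: asymp_ideal_r|apply: asymp_ideal_lr].
    apply: asymp_near_eq; apply: nearW => u.
    rewrite !inuM -ustar_inu inuB -/x1 -/y1 -/d1 expand.
    by rewrite d1E !ustarM !mulrA.
  have h' := asymp_unorm_le (FF := FF) (B := 768 * B ^+ 3 * s%:R^-1 ^+ 24) asym _ e0.
  have h : quasicentral I [set _ : U |
      unorm (inu ((x k - D k) ** Y k ** star (x k - D k))) <= 768 * B ^+ 3 * s%:R^-1 ^+ 24]%classic.
    by apply: (@filterS _ _ FF setT) (@filterT _ _ FF) => u _ /=; rewrite unorm_inu.
  by apply: (@filterS _ _ FF _ _ _ (h' h)) => u; rewrite unorm_inu.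
have near_all := @filterI _ (quasicentral I) FF _ _ (near_quasicentral_ideal I) near_t.
have [u [[uI us u1] ut]] := @filter_ex _ _ (quasicentral_filter I) _ near_all.
have un : unorm u <= 2.
  have := unorm_tri 1 u 0; rewrite !subr0 unormB; have := unorm1_le A; lra.
exists (X u), Y; split=> //.
- apply: (lifts_ideal xy) => k; rewrite subKr //.
  by apply/uideal_inu; rewrite inu_lact; apply: uidealMr.
- move=> k; rewrite addrAC subrr add0r rnormN; apply: le_trans (unormP _ _) _.
  have [Dn _ _ _] := hf k.
  have := ler_pM (unorm_ge0 _) (rnorm_ge0 _) un Dn; rewrite -/(D k); lra.
- by move=> k; rewrite addrAC subrr add0r rnormN; have [_] := hf k.
Qed.

(* The relation has to hold to a much higher order than the norm conditions:  *)
(* the correction of [y] in [approximate_correction] multiplies its error by  *)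
(* [s ^ 16].                                                                  *)
Definition small (s : nat) x y : Prop :=
  (forall k, tval k x y <= s%:R^-1 ^+ 20) /\ (forall j, pval j x y <= C j + s%:R^-1).

Definition vbound (B : R) (i : nat) : R :=
  if (i < 2 * r)%N then B else rnorm (z (i - 2 * r)%N).

Lemma xyz_vbound B x y : (forall k, rnorm (x k) <= B) -> (forall k, rnorm (y k) <= B) ->
  forall i, rnorm (xyz x y z i) <= vbound B i.
Proof.
move=> xB yB i; rewrite /vbound.
by case: (xyzP r i) => [[k -> ->]|[k -> ->]|[/negbTE -> ->]].
Qed.

Lemma xyz_dist e x y x' y' : 0 <= e ->
  (forall k, rnorm (x k - x' k) <= e) -> (forall k, rnorm (y k - y' k) <= e) ->
  forall i, rnorm (xyz x y z i - xyz x' y' z i) <= e.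
Proof.
move=> e0 xe ye i.
by case: (xyzP r i) => [[k _ E]|[k _ E]|[_ E]]; rewrite !E // subrr rnorm0.
Qed.

Lemma pval_lipschitz (B : R) : exists2 K, 0 <= K & forall j x y x' y' e, 0 <= e ->
  (forall k, rnorm (x k) <= B) -> (forall k, rnorm (y k) <= B) ->
  (forall k, rnorm (x' k) <= B) -> (forall k, rnorm (y' k) <= B) ->
  (forall k, rnorm (x' k - x k) <= e) -> (forall k, rnorm (y' k - y k) <= e) ->
  pval j x' y' <= pval j x y + K * e.
Proof.
have /choice[K hK] j : exists K, 0 <= K /\
    lipschitz_on (vbound B) (fun v : nat -> A => eval_ncpoly v (p j)) K.
  by have [K] := eval_ncpoly_lipschitz A (vbound B) (p j); exists K.
have K0 j : 0 <= K j by case: (hK j).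
exists (\sum_j K j) => [|j x y x' y' e e0 xB yB x'B y'B xx yy]; first exact: sumr_ge0.
have [_ /(_ (xyz x' y' z) (xyz x y z) e)] := hK j.
case=> [||| _ h]; try exact: xyz_vbound; first exact: xyz_dist.
have KS : K j <= \sum_j K j by rewrite (bigD1 j) //= lerDl sumr_ge0.
have := rnormD (eval_ncpoly (xyz x' y' z) (p j) - eval_ncpoly (xyz x y z) (p j))
  (eval_ncpoly (xyz x y z) (p j)); rewrite subrK.
have := ler_wpM2r e0 KS; rewrite /pval; lra.
Qed.

Lemma tval_lipschitz (B : R) : exists2 K, 0 <= K & forall k x y x' y' e, 0 <= e ->
  (forall k, rnorm (x k) <= B) -> (forall k, rnorm (y k) <= B) ->
  (forall k, rnorm (x' k) <= B) -> (forall k, rnorm (y' k) <= B) ->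
  (forall k, rnorm (x' k - x k) <= e) -> (forall k, rnorm (y' k - y k) <= e) ->
  tval k x' y' <= tval k x y + K * e.
Proof.
have /choice[K hK] k : exists K, 0 <= K /\
    lipschitz_on (vbound B) (fun v : nat -> A => eval_word v (tword k)) K.
  by have [K] := eval_word_lipschitz A (vbound B) (tword k); exists K.
have K0 j : 0 <= K j by case: (hK j).
exists (\sum_j K j) => [|k x y x' y' e e0 xB yB x'B y'B xx yy]; first exact: sumr_ge0.
have [_ /(_ (xyz x' y' z) (xyz x y z) e)] := hK k.
case=> [||| _ h]; try exact: xyz_vbound; first exact: xyz_dist.
have KS : K k <= \sum_j K j by rewrite (bigD1 k) //= lerDl sumr_ge0.
have := rnormD (eval_word (xyz x' y' z) (tword k) - eval_word (xyz x y z) (tword k))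
  (eval_word (xyz x y z) (tword k)); rewrite subrK.
have := ler_wpM2r e0 KS; rewrite !eval_tword /tval; rewrite !eval_tword in h; lra.
Qed.

(** Correction comes before damping: it creates a norm excess O(1/s), whereas damping spoils neither
    condition by more than an arbitrary [e]. *)
Lemma lifting_step (B : R) : 1 <= B -> exists2 c : R, 0 <= c & exists s0 : R,
  forall (s : nat) x y, (0 < s)%N -> s0 <= s%:R -> lifts x y -> small s x y ->
    (forall k, rnorm (x k) <= B) -> (forall k, rnorm (y k) <= B) ->
  exists x' y', [/\ lifts x' y', small (2 * s) x' y',
    forall k, rnorm (x' k - x k) <= c / s%:R & forall k, rnorm (y' k - y k) <= c / s%:R].
Proof.
move=> B1.
pose c1 := 64 * (2 * B ^+ 2 + 1).
have B2 : 1 <= B ^+ 2 by rewrite exprn_ege1.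
have c1_64 : 64 <= c1 by rewrite /c1; lra.
have [K K0 HK] := pval_lipschitz (B + c1).
(* Norm excess after correction, in units of 1/s: the former excess plus the Lipschitz effect of the
   move. *)
pose c2 := 1 + K * c1.
have c20 : 0 <= c2 by rewrite /c2 addr_ge0 // mulr_ge0 //; lra.
(* The sum dominates every [c2 / C j], so t = c3/s brings C_j + c2/s below [C j] for all j at
   once. *)
pose c3 := \sum_j c2 / C j.
have c30 : 0 <= c3 by apply: sumr_ge0 => j _; rewrite divr_ge0 // ltW.
have c3C j : c2 <= c3 * C j.
  rewrite -ler_pdivrMr // /c3 (bigD1 j) //= lerDl.
  by apply: sumr_ge0 => i _; rewrite divr_ge0 // ltW.
have BC : 0 <= B + c1 by lra.
have [T hT] : exists T, forall w : R, 0 <= w <= 1 -> T * w <= 1 ->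
    768 * B ^+ 3 * w ^+ 24 <= (w / 2) ^+ 20 / 2.
  have B0 : 0 <= B by lra.
  have b0 : 0 <= 768 * B ^+ 3 by exact: mulr_ge0 (ler0n _ 768) (exprn_ge0 3 B0).
  exists (768 * B ^+ 3 * 2 ^+ 21) => w w01; move: (768 * _) b0 => b b0.
  exact: (@scaled_power_le R b w 20 3 w01 b0).
exists (c1 + 2 * c3 * (B + c1)); first by rewrite addr_ge0 ?mulr_ge0 //; lra.
exists (Num.max c3 T) => s x y s1; rewrite ge_max.
move=> /andP[sc3 sB] xy [txy pxy] xB yB.
have sR : 0 < s%:R :> R by rewrite ltr0n.
have sge1 : 1 <= s%:R :> R by rewrite ler1n.
pose w : R := s%:R^-1.
have w0 : 0 < w by rewrite /w invr_gt0.
have w1 : w <= 1 by rewrite /w invf_le1.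
have w2 : (2 * s)%:R^-1 = w / 2 :> R by rewrite natrM invfM mulrC.
(* [D] is half of the new tolerance; the other half pays for the two errors [e] <= [D / 2] of
   correction and damping. *)
have [D [D0 key DE]] : exists D : R,
    [/\ 0 < D, 768 * B ^+ 3 * w ^+ 24 <= D & (w / 2) ^+ 20 = D + D].
  exists ((w / 2) ^+ 20 / 2); split; last by rewrite -splitr.
    by rewrite divr_gt0 // exprn_gt0 // divr_gt0.
  by apply: hT; rewrite ?w1 ?(ltW w0) // /w ler_pdivrMr // mul1r.
pose e := Num.min (D / 2) (w / 2).
have e0 : 0 < e by rewrite lt_min (divr_gt0 D0) //= divr_gt0.
have eD : e <= D / 2 by rewrite ge_min lexx.
have ew : e <= w / 2 by rewrite ge_min lexx orbT.
have [x1 [y1 [xy1 x1x y1y t1]]] := correction_step B1 s1 e0 xy xB yB txy.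
have c1w : c1 * w <= c1 by rewrite ler_piMr //; lra.
have c1w0 : 0 <= c1 * w by rewrite mulr_ge0 ?(ltW w0) //; lra.
have {}y1y k : rnorm (y1 k - y k) <= c1 * w.
  by apply: le_trans (y1y k) _; rewrite ler_wpM2r // ltW.
have x1B k : rnorm (x1 k) <= B + c1.
  have := rnormD (x1 k - x k) (x k); rewrite subrK.
  have := x1x k; have := xB k; rewrite -/c1 -/w; lra.
have y1B k : rnorm (y1 k) <= B + c1.
  have := rnormD (y1 k - y k) (y k); rewrite subrK.
  have := y1y k; have := yB k; lra.
have p1 j : pval j x1 y1 <= C j + c2 * w.
  have := HK j x y x1 y1 (c1 * w) c1w0.
  have xB' k : rnorm (x k) <= B + c1 by have := xB k; lra.
  have yB' k : rnorm (y k) <= B + c1 by have := yB k; lra.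
  move=> /(_ xB' yB' x1B y1B x1x y1y); have := pxy j; rewrite -/w /c2; lra.
pose t := c3 * w.
have t01 : 0 <= t <= 1.
  by rewrite mulr_ge0 ?(ltW w0) //= /t /w ler_pdivrMr // mul1r.
have pt j : (1 - t) * pval j x1 y1 <= C j.
  have h1 : (1 - t) * pval j x1 y1 <= (1 - t) * (C j + c2 * w).
    by rewrite ler_wpM2l //; lra.
  have h2 : c2 * w <= t * C j by rewrite /t mulrAC ler_wpM2r // ltW.
  have h3 : 0 <= t * (c2 * w) by rewrite !mulr_ge0 ?(ltW w0) //; lra.
  lra.
have tt k : (1 - t) * tval k x1 y1 <= D + e.
  have := t1 k; rewrite -/w => tk; apply: (@le_trans _ _ (tval k x1 y1)).
    by rewrite ler_piMl ?rnorm_ge0 //; lra.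
  by apply: le_trans tk _; rewrite lerD2r.
have De : 0 <= D + e by rewrite addr_ge0 ?ltW.
have [x2 [y2 [xy2 _ x2x p2 t2]]] := damping_step t01 e0 De xy1 pt tt.
exists x2, y2; split=> //.
- split=> [k|j]; rewrite w2.
    by apply: le_trans (t2 k) _; rewrite DE; lra.
  by have := p2 j; lra.
- move=> k; have [h _] := x2x k; have := x1x k; rewrite -/c1 -/w => h1.
  have := rnorm_tri (x1 k) (x2 k) (x k).
  have := ler_wpM2l (mulr_ge0 (ler0n _ 2) (mulr_ge0 c30 (ltW w0))) (x1B k).
  rewrite /t in h; lra.
- move=> k; have [_ h] := x2x k; have h1 := y1y k.
  have := rnorm_tri (y1 k) (y2 k) (y k).
  have := ler_wpM2l (mulr_ge0 (ler0n _ 2) (mulr_ge0 c30 (ltW w0))) (y1B k).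
  rewrite /t in h; rewrite -/w; lra.
Qed.

(** At scale s 2^i the step moves by at most 2^-(i+1), so the iterates converge within a fixed ball,
    while all errors tend to 0. *)
Lemma lifting_exists : exists x y, [/\ lifts x y,
  forall k, x k ** y k ** star (x k) = 0 & forall j, pval j x y <= C j].
Proof.
pose B0 := 1 + (\sum_k rnorm (x0 k) + \sum_k rnorm (y0 k)).
have Sx : 0 <= \sum_k rnorm (x0 k) by apply: sumr_ge0 => k _; apply: rnorm_ge0.
have Sy : 0 <= \sum_k rnorm (y0 k) by apply: sumr_ge0 => k _; apply: rnorm_ge0.
have x0B k : rnorm (x0 k) <= B0.
  have : rnorm (x0 k) <= \sum_k rnorm (x0 k).
    by rewrite (bigD1 k) //= lerDl sumr_ge0 // => i _; apply: rnorm_ge0.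
  rewrite /B0; lra.
have y0B k : rnorm (y0 k) <= B0.
  have : rnorm (y0 k) <= \sum_k rnorm (y0 k).
    by rewrite (bigD1 k) //= lerDl sumr_ge0 // => i _; apply: rnorm_ge0.
  rewrite /B0; lra.
(* The displacements total at most 1, so the constants for radius [B0 + 1] serve every step. *)
have B1 : 1 <= B0 + 1 by rewrite /B0; lra.
have [c c0 [s1 step]] := lifting_step B1.
pose h : R := 2^-1.
have hp i : 0 <= h ^+ i by rewrite exprn_ge0 // invr_ge0.
have hle1 i : h ^+ i <= 1 by rewrite exprn_ile1 ?invr_ge0 // invf_le1 // ler1n.
have [s [s0 ss1 sc]] : exists s : nat, [/\ (0 < s)%N, s1 <= s%:R & c / s%:R <= h].
  have [n n0 nc] := @exists_inv_le R (h / (1 + c)) (ltac:(rewrite divr_gt0 ?invr_gt0 //; lra)).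
  have m1 : s1 <= (Num.bound `|s1|)%:R.
    by apply: le_trans (ler_norm _) (ltW (archi_boundP _)).
  exists (n + Num.bound `|s1|)%N; split; first by rewrite ltn_addr.
    by apply: le_trans m1 _; rewrite ler_nat leq_addl.
  have nR : 0 < n%:R :> R by rewrite ltr0n.
  apply: (@le_trans _ _ (c / n%:R)).
    by rewrite ler_wpM2l // lef_pV2 ?posrE ?ler_nat ?leq_addr // ltr0n ltn_addr.
  apply: le_trans (ler_wpM2l c0 nc) _; rewrite mulrCA ler_piMr ?invr_ge0 //.
  by rewrite ler_pdivrMr; lra.
have sR : 0 < s%:R :> R by rewrite ltr0n.
pose S i := (s * 2 ^ i)%N.
have S0 i : (0 < S i)%N by rewrite muln_gt0 s0 expn_gt0.
have SV i : (S i)%:R^-1 = s%:R^-1 * h ^+ i :> R.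
  by rewrite natrM invfM natrX exprVn.
have sV : 0 < s%:R^-1 :> R by rewrite invr_gt0.
have sV1 : s%:R^-1 <= 1 :> R by rewrite invf_le1 // ler1n.
have SVh i : (S i)%:R^-1 <= h ^+ i by rewrite SV ler_piMl.
pose good i x y := [/\ lifts x y, small (S i) x y,
  forall k, rnorm (x k) <= B0 + (1 - h ^+ i) & forall k, rnorm (y k) <= B0 + (1 - h ^+ i)].
have goodB i x y : good i x y ->
    (forall k, rnorm (x k) <= B0 + 1) /\ (forall k, rnorm (y k) <= B0 + 1).
  move=> [_ _ xB yB]; have := hp i.
  by split=> k; [have := xB k|have := yB k]; lra.
have init : exists x y, good 0%N x y.
  have t01 : 0 <= (1 : R) <= 1 by rewrite ler01 lexx.
  have e0 : 0 < s%:R^-1 ^+ 20 :> R by rewrite exprn_gt0.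
  (* Full damping, t = 1: the size hypotheses carry the factor [1 - t] = 0, so arbitrary lifts can
     be used as input. *)
  have [|j|k|x [y [xy nxy _ pxy txy]]] := @damping_step x0 y0 1 0 _ t01 e0 (lexx 0).
  - by [].
  - by rewrite subrr mul0r ltW.
  - by rewrite subrr mul0r.
  exists x, y; split=> //.
  - rewrite /S muln1; split=> [k|j]; first by rewrite -[leRHS]add0r.
    apply: le_trans (pxy j) _; rewrite lerD2l -[leRHS]expr1.
    by rewrite ler_wiXn2l // ltW.
  - by move=> k; have [] := nxy k; have := x0B k; rewrite subrr addr0; lra.
  - by move=> k; have [] := nxy k; have := y0B k; rewrite subrr addr0; lra.
(* Dependent choice needs a total relation, so goodness is a premise inside it; a pair that is not
   good may keep its components. *)
pose rel (a b : nat * (('I_r -> A) * ('I_r -> A))) :=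
  b.1 = a.1.+1 /\ (good a.1 a.2.1 a.2.2 -> good b.1 b.2.1 b.2.2 /\
   ((forall k, rnorm (b.2.1 k - a.2.1 k) <= h * h ^+ a.1) /\
    (forall k, rnorm (b.2.2 k - a.2.2 k) <= h * h ^+ a.1))).
have next a : exists b, rel a b.
  case: a => i [x y]; have [g|ng] := pselect (good i x y); last first.
    by exists (i.+1, (x, y)).
  have [xB yB] := goodB _ _ _ g; have [xy sxy xBi yBi] := g.
  have ss : s1 <= (S i)%:R.
    by apply: le_trans ss1 _; rewrite ler_nat leq_pmulr // expn_gt0.
  have [x' [y' [xy' sxy' xx' yy']]] := step (S i) x y (S0 i) ss xy sxy xB yB.
  have cS : c / (S i)%:R <= h * h ^+ i by rewrite SV mulrA ler_wpM2r ?hp.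
  have hi : h ^+ i = h * h ^+ i + h * h ^+ i.
    have hh : h + h = 1 by rewrite /h; lra.
    by rewrite -mulrDl hh mul1r.
  exists (i.+1, (x', y')); split=> //= _; split; last first.
    by split=> k; [apply: le_trans (xx' k) _|apply: le_trans (yy' k) _].
  split=> //.
  - by rewrite /S expnS mulnCA; apply: sxy'.
  - move=> k; have := rnormD (x' k - x k) (x k); rewrite subrK exprS.
    have := xx' k; have := xBi k; lra.
  - move=> k; have := rnormD (y' k - y k) (y k); rewrite subrK exprS.
    have := yy' k; have := yBi k; lra.
have [xi [yi gi]] := init.
have [f [f0 fS]] := dependent_choice (fun a => cid (next a)) (0%N, (xi, yi)).
have f1 i : (f i).1 = i.
  by elim: i => [|i IH]; [rewrite f0|have [-> _] := fS i; rewrite IH].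
pose X i := (f i).2.1; pose Y i := (f i).2.2.
have gX i : good i (X i) (Y i).
  elim: i => [|i IH]; first by rewrite /X /Y f0.
  have [_ /(_ _)] := fS i; rewrite !f1 => /(_ IH)[] //.
have dX i : (forall k, rnorm (X i.+1 k - X i k) <= h * h ^+ i) /\
            (forall k, rnorm (Y i.+1 k - Y i k) <= h * h ^+ i).
  by have [_ /(_ _)] := fS i; rewrite !f1 => /(_ (gX i))[].
have h2 i : 2 * h * h ^+ i = h ^+ i by rewrite /h divff // mul1r.
have /choice[x hx] k : exists l, forall i, rnorm (X i k - l) <= h ^+ i.
  have [l hl] := geometric_cauchy_cvg (fun i => proj1 (dX i) k).
  by exists l => i; rewrite -h2.
have /choice[y hy] k : exists l, forall i, rnorm (Y i k - l) <= h ^+ i.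
  have [l hl] := geometric_cauchy_cvg (fun i => proj2 (dX i) k).
  by exists l => i; rewrite -h2.
have XB i k : rnorm (X i k) <= B0 + 2.
  by have [/(_ k) + _] := goodB _ _ _ (gX i); lra.
have YB i k : rnorm (Y i k) <= B0 + 2.
  by have [_ /(_ k)] := goodB _ _ _ (gX i); lra.
have xB k : rnorm (x k) <= B0 + 2.
  have := rnormD (x k - X 0%N k) (X 0%N k); rewrite subrK rnormB.
  by have := hx k 0%N; have [/(_ k) + _] := goodB _ _ _ (gX 0%N); rewrite expr0; lra.
have yB k : rnorm (y k) <= B0 + 2.
  have := rnormD (y k - Y 0%N k) (Y 0%N k); rewrite subrK rnormB.
  by have := hy k 0%N; have [_ /(_ k)] := goodB _ _ _ (gX 0%N); rewrite expr0; lra.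
have hx' i k : rnorm (x k - X i k) <= h ^+ i by rewrite rnormB.
have hy' i k : rnorm (y k - Y i k) <= h ^+ i by rewrite rnormB.
exists x, y; split.
- apply: (@lifts_ideal x0 y0) => // k; apply: ideal_limit => e e0.
    have [i hi] := exp_half_small 1 e0; rewrite mul1r in hi.
    exists (x0 k - X i k); last first.
      by rewrite opprB addrC addrA subrK (le_trans (hx k i)).
    by have [/(_ k)[xk _] _ _ _] := gX i; apply/cquotP.
  have [i hi] := exp_half_small 1 e0; rewrite mul1r in hi.
  exists (y0 k - Y i k); last first.
    by rewrite opprB addrC addrA subrK (le_trans (hy k i)).
  by have [/(_ k)[_ yk] _ _ _] := gX i; apply/cquotP.
- move=> k; apply: rnorm_eps0 => e e0; have [K K0 HK] := tval_lipschitz (B0 + 2).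
  have [i hi] := exp_half_small (1 + K) e0.
  have := HK k (X i) (Y i) x y (h ^+ i) (hp i) (XB i) (YB i) xB yB (hx' i) (hy' i).
  have [_ [/(_ k) tX _] _ _] := gX i.
  have : (S i)%:R^-1 ^+ 20 <= h ^+ i.
    apply: le_trans (SVh i); rewrite -[leRHS]expr1 ler_wiXn2l //.
    exact: le_trans (SVh i) (hle1 i).
  rewrite -/(tval k x y) -/h in hi *; lra.
- move=> j; apply/ler_addgt0Pl => e e0; have [K K0 HK] := pval_lipschitz (B0 + 2).
  have [i hi] := exp_half_small (1 + K) e0.
  have := HK j (X i) (Y i) x y (h ^+ i) (hp i) (XB i) (YB i) xB yB (hx' i) (hy' i).
  have [_ [_ /(_ j) pX] _ _] := gX i; have := SVh i.
  rewrite -/h in hi; lra.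
Qed.

End Lifting.

Theorem theorem3p3 (R : realType) (r J : nat) (hr : (1 <= r)%N) (hJ : (1 <= J)%N)
    (p : 'I_J -> ncpoly R) (d : 'I_J -> nat)
    (hd : forall j, (1 <= d j)%N)
    (hp : forall j, homogeneous (fun i => (i < 2 * r)%N) (d j) (p j))
    (C : 'I_J -> R) (hC : forall j, 0 < C j)
    (A : cstarAlgType R) (I : cstarIdeal A)
    (x y : 'I_r -> A) (z : nat -> A)
    (hxy : forall k : 'I_r,
        \pi_(cquot I) (x k) ** \pi_(cquot I) (y k) ** star (\pi_(cquot I) (x k))
        = 0 :> cquot I)
    (hnorm : forall j : 'I_J,
        `| eval_ncpoly (xyz (fun k => \pi_(cquot I) (x k))
                            (fun k => \pi_(cquot I) (y k))
                            (fun n => \pi_(cquot I) (z n)) : nat -> cquot I)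
             (p j) | <= (C j)%:C) :
  exists (x' y' : 'I_r -> A),
    [/\ forall k : 'I_r, \pi_(cquot I) (x' k) = \pi_(cquot I) (x k),
        forall k : 'I_r, \pi_(cquot I) (y' k) = \pi_(cquot I) (y k),
        forall k : 'I_r, x' k ** y' k ** star (x' k) = 0
      & forall j : 'I_J, `| eval_ncpoly (xyz x' y' z) (p j) | <= (C j)%:C].
Proof.
have [x' [y' [xy' t0 pC]]] := lifting_exists hd hp hC hxy hnorm.
exists x', y'; split=> // [k|k|j]; try by case: (xy' k).
by rewrite -rnormE lecR; apply: pC.
Qed.
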